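(* Let $b,c,r\in\mathbb{N}$, $a\in\mathbb{N}_0$ with $0\le b-a\le c$. Then for every positive integer $n\ge 2/c$, \[ \left|\gamma-\frac{((cn)!)^2}{(2cn)!\,r^{2cn}}\sum_{k=0}^{2cn}(-1)^k\binom{2cn}{k}\binom{rk+(a+c)n}{cn}^2S_{rk+bn}\right|<cn\left(\frac{b^{b/r}c^c(c+a-b)^{c+a-b}(b-a)^{b-a}}{(b+2cr)^{2c+b/r}}\right)^n . \]
   Context: $\gamma$ is Euler's constant; $S_n=\sum_{k=1}^n\frac1k-\log(n+1)$. The convention $0^0=1$ is used. *)

(* Defs.v *)
From Stdlib Require Import Reals.
From Coquelicot Require Import Coquelicot.
Open Scope R_scope.

Definition harmonic (n : nat) : R := sum_n_m (fun k => / INR k) 1 n.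

(* The value [ln 0] at [n = 0] is junk, but does not affect the limit. *)
Definition euler_gamma : R :=
  real (Lim_seq (fun n => harmonic n - ln (INR n))).

Definition S_ (n : nat) : R := harmonic n - ln (INR n + 1).

(* [Binomial.C] is the true binomial coefficient only for [k <= n]; outside
   that range it is not 0.  [C] alone is Coquelicot's type of complex numbers. *)
Definition binom (n k : nat) : R := Binomial.C n k.

(* Main.v *)
(* With m = cn, N = 2m and P(y) = C(y + (a+c)n, m), the N-th difference of P(rk)^2 is
   constant, so the error is a multiple of sum_k (-1)^k C(N,k) P(rk)^2 (gamma - S_(rk+bn)).
   Now gamma - S_j = int_0^1 u^j w(u) du with w(u) = 1/(1-u) + 1/ln u, and w is a Stieltjes
   function: a positive superposition of the poles 1/(u+x), x > 0.  For a single pole,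
   2m integrations by parts turn the sum into
     +- x^q int_0^1 u^(an+m) (1-u^r)^N P_m((u-x)/(u+x)) / (u+x)^(m+1) du,  q = (b-a)n,
   with P_m the Legendre polynomial.  As |P_m| <= 1, this is at most
   max u^(bn) (1-u^r)^N * max y^q (1-y)^(m-q) * int_0^1 du/(u+x).  Superposing, the last
   integral becomes int_0^1 w = gamma <= 2/3, and 4^m/C(2m,m) <= 4m/3 for m >= 2.

   Positivity of w is obtained from w(u) = 1/2 / (1 + sqrt u) + 1/2 w(sqrt u), since
   Stieltjes functions are preserved by f |-> f o sqrt. *)
Require Import Defs.
From Stdlib Require Import Reals Factorial Lra Lia IndefiniteDescription.
From Coquelicot Require Import Coquelicot.
Open Scope R_scope.

(** * Finite differences *)

(** The function w has removable singularities at both ends of [0, 1] and never appears in the code.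
    Its iterates [gamma_weight K] under the square-root equation stand in for it, and K goes to
    infinity only at the end, where finitely many moments are involved. In the same spirit Stieltjes
    functions are a closure under nonnegative combinations and uniform limits, without a
    representing measure: an estimate |int p f| <= B int f is stable under just these operations.
    The square of P matters: each of its two factors pays for m integrations by parts, and all
    boundary terms are differences of order 2m of polynomials of smaller degree. The condition b - a
    <= c means q <= m, which lets a factor of P absorb the denominators that appear when the
    exponent rk + bn is lowered to rk + an. *)

Lemma sum_f_R0_scal_l (f : nat -> R) (a : R) (N : nat) :
  sum_f_R0 (fun k => a * f k) N = a * sum_f_R0 f N.
Proof. induction N as [|N IH]; simpl; [|rewrite IH]; ring. Qed.

Lemma sum_f_R0_swap (f : nat -> nat -> R) (M N : nat) :
  sum_f_R0 (fun i => sum_f_R0 (f i) N) M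
  = sum_f_R0 (fun j => sum_f_R0 (fun i => f i j) M) N.
Proof.
  induction M as [|M IH]; simpl; [reflexivity|].
  rewrite IH, <- sum_plus; reflexivity.
Qed.

(** For a polynomial of degree at most d, v is d! times the coefficient of degree d. The predicate
    thus tracks degree and leading coefficient without a type of polynomials. *)
Fixpoint const_diff (d : nat) (v : R) (g : nat -> R) : Prop :=
  match d with
  | O => forall k, g k = v
  | S d' => const_diff d' v (fun k => g (S k) - g k)
  end.

Lemma const_diff_ext d v f g :
  (forall k, f k = g k) -> const_diff d v f -> const_diff d v g.
Proof.
  revert f g; induction d as [|d IH]; simpl; intros f g E H.
  - intros k; rewrite <- E; apply H.
  - apply (IH _ _ (fun k => f_equal2 Rminus (E (S k)) (E k)) H).
Qed.

Lemma const_diff_comb d s t v w f g :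
  const_diff d v f -> const_diff d w g ->
  const_diff d (s * v + t * w) (fun k => s * f k + t * g k).
Proof.
  revert f g; induction d as [|d IH]; simpl; intros f g Hf Hg.
  - intros k; rewrite Hf, Hg; reflexivity.
  - apply (const_diff_ext _ _ (fun k => s * (f (S k) - f k) + t * (g (S k) - g k)));
      [intros k; ring | now apply IH].
Qed.

Lemma const_diff_shift d v g :
  const_diff d v g -> const_diff d v (fun k => g (S k)).
Proof.
  revert g; induction d as [|d IH]; simpl; intros g H; [intros k; apply H|].
  apply (IH _ H).
Qed.

Lemma const_diff_S d v g : const_diff d v g -> const_diff (S d) 0 g.
Proof.
  revert g; induction d as [|d IH]; intros g H.
  - intros k; simpl in H; rewrite !H; ring.
  - apply (IH _ H).
Qed.

Lemma const_diff_lt d d' v g :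
  (d < d')%nat -> const_diff d v g -> const_diff d' 0 g.
Proof.
  intros Hd; revert v; induction Hd as [|d' Hd IH]; intros v H.
  - apply (const_diff_S _ _ _ H).
  - apply (const_diff_S _ 0), (IH v), H.
Qed.

(** Discrete Leibniz rule: the difference of (s k + t) g(k) is (s k + t) times the difference of g,
    plus s g(k+1). Each of the d + 1 differences contributes one s. *)
Lemma const_diff_mul_affine d v g s t :
  const_diff d v g ->
  const_diff (S d) (INR (S d) * s * v) (fun k => (s * INR k + t) * g k).
Proof.
  revert v g; induction d as [|d IH]; intros v g H.
  - simpl in H.
    change (forall k, (s * INR (S k) + t) * g (S k) - (s * INR k + t) * g k
                      = 1 * s * v).
    intros k; rewrite !H, S_INR; ring.
  - pose proof (IH _ _ H) as H1; apply const_diff_shift in H as H2.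
    apply (const_diff_ext (S d) _
      (fun k => 1 * ((s * INR k + t) * (g (S k) - g k)) + s * g (S k))).
    { intros k; rewrite S_INR; ring. }
    replace (INR (S (S d)) * s * v) with (1 * (INR (S d) * s * v) + s * v)
      by (rewrite (S_INR (S d)); ring).
    now apply (const_diff_comb (S d)).
Qed.

Definition alt_binom (N k : nat) : R := (-1) ^ k * Binomial.C N k.

Lemma C_n_0 n : Binomial.C n 0 = 1.
Proof.
  unfold Binomial.C; rewrite Nat.sub_0_r; simpl fact; simpl INR.
  field; apply INR_fact_neq_0.
Qed.

Lemma C_n_n n : Binomial.C n n = 1.
Proof. rewrite pascal_step1, Nat.sub_diag by lia; apply C_n_0. Qed.

Lemma sum_alt_binom_S N g :
  sum_f_R0 (fun k => alt_binom (S N) k * g k) (S N)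
  = - sum_f_R0 (fun k => alt_binom N k * (g (S k) - g k)) N.
Proof.
  unfold alt_binom.
  destruct N as [|N].
  { simpl; rewrite !C_n_0, C_n_n; ring. }
  set (M := S N).
  (* Pascal's rule needs k < M, since [Binomial.C M (S M)] is not 0; the two extreme terms are
     treated apart. *)
  assert (E : sum_f_R0 (fun k => (-1) ^ S k * Binomial.C (S M) (S k) * g (S k)) N
    = - sum_f_R0 (fun k => (-1) ^ k * Binomial.C M k * g (S k)) N
      + sum_f_R0 (fun k => (-1) ^ S k * Binomial.C M (S k) * g (S k)) N).
  { replace (- sum_f_R0 (fun k => (-1) ^ k * Binomial.C M k * g (S k)) N)
      with (-1 * sum_f_R0 (fun k => (-1) ^ k * Binomial.C M k * g (S k)) N) by ring.
    rewrite <- sum_f_R0_scal_l, <- sum_plus; apply sum_eq; intros k Hk.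
    rewrite <- pascal by (unfold M; lia); simpl; ring. }
  rewrite (decomp_sum (fun k => (-1) ^ k * Binomial.C (S M) k * g k) (S M)) by lia.
  rewrite (sum_eq (fun k => (-1) ^ k * Binomial.C M k * (g (S k) - g k))
    (fun k => (-1) ^ k * Binomial.C M k * g (S k)
              + -1 * ((-1) ^ k * Binomial.C M k * g k))) by (intros; ring).
  rewrite sum_plus, sum_f_R0_scal_l.
  rewrite (decomp_sum (fun k => (-1) ^ k * Binomial.C M k * g k) M)
    by (unfold M; lia).
  change (pred (S M)) with (S N); change (pred M) with N.
  rewrite (tech5 (fun i => (-1) ^ S i * Binomial.C (S M) (S i) * g (S i)) N), E.
  assert (E2 : sum_f_R0 (fun k => (-1) ^ k * Binomial.C M k * g (S k)) M
    = sum_f_R0 (fun k => (-1) ^ k * Binomial.C M k * g (S k)) N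
      + (-1) ^ M * Binomial.C M M * g (S M)) by apply tech5.
  rewrite E2; fold M.
  rewrite !C_n_0, !C_n_n; simpl; ring.
Qed.

Lemma sum_alt_binom N v g :
  const_diff N v g ->
  sum_f_R0 (fun k => alt_binom N k * g k) N = (-1) ^ N * v.
Proof.
  revert v g; induction N as [|N IH]; intros v g H.
  - simpl in *; unfold alt_binom; rewrite C_n_0, H; simpl; ring.
  - rewrite sum_alt_binom_S, (IH v _ H); simpl; ring.
Qed.

(** The product (y+1)...(y+m). Starting at y + 1 makes C(y+m, m) this product over m!, and matches
    the factor e + 1 that one integration by parts of u^e produces. *)
Fixpoint rising (y : R) (m : nat) : R :=
  match m with
  | O => 1
  | S m' => (y + 1) * rising (y + 1) m'
  end.

Lemma rising_S y m : rising y (S m) = rising y m * (y + INR (S m)).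
Proof.
  revert y; induction m as [|m IH]; intros y; [simpl; ring|].
  change (rising y (S (S m))) with ((y + 1) * rising (y + 1) (S m)).
  rewrite IH, (S_INR (S m)); simpl; ring.
Qed.

Lemma rising_add y m k : rising y (m + k) = rising y m * rising (y + INR m) k.
Proof.
  revert y; induction m as [|m IH]; intros y.
  - simpl; rewrite Rplus_0_r; ring.
  - change ((y + 1) * rising (y + 1) (m + k)
            = (y + 1) * rising (y + 1) m * rising (y + INR (S m)) k).
    rewrite IH, S_INR; replace (y + 1 + INR m) with (y + (INR m + 1)) by ring; ring.
Qed.

Lemma C_rising (y m : nat) :
  Binomial.C (y + m) m = rising (INR y) m / INR (fact m).
Proof.
  unfold Binomial.C; replace (y + m - m)%nat with y by lia.
  pose proof (INR_fact_neq_0 m); pose proof (INR_fact_neq_0 y).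
  assert (E : INR (fact (y + m)) = INR (fact y) * rising (INR y) m).
  { clear; induction m as [|m IH].
    - rewrite Nat.add_0_r; simpl; ring.
    - replace (y + S m)%nat with (S (y + m)) by lia.
      rewrite fact_simpl, mult_INR, IH, rising_S, !S_INR, plus_INR; ring. }
  rewrite E; field; auto.
Qed.

Lemma rising_0 m : rising 0 m = INR (fact m).
Proof.
  pose proof (C_rising 0 m) as E; simpl in E; rewrite C_n_n in E.
  pose proof (INR_fact_neq_0 m) as H.
  apply (Rmult_eq_reg_r (/ INR (fact m))); [|now apply Rinv_neq_0_compat].
  unfold Rdiv in E; rewrite <- E; field; assumption.
Qed.

Lemma const_diff_mul_rising d v g s t m :
  const_diff d v g ->
  const_diff (d + m) (rising (INR d) m * s ^ m * v)
    (fun k => rising (s * INR k + t) m * g k).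
Proof.
  intros H; induction m as [|m IH].
  - rewrite Nat.add_0_r.
    apply (const_diff_ext _ _ g); [intros; simpl; ring|].
    replace (rising (INR d) 0 * s ^ 0 * v) with v by (simpl; ring); assumption.
  - apply (const_diff_mul_affine _ _ _ s (t + INR (S m))) in IH.
    replace (d + S m)%nat with (S (d + m)) by lia.
    replace (rising (INR d) (S m) * s ^ S m * v)
      with (INR (S (d + m)) * s * (rising (INR d) m * s ^ m * v)).
    2:{ rewrite rising_S, !S_INR, plus_INR; simpl; ring. }
    refine (const_diff_ext _ _ _ _ _ IH).
    intros k; rewrite rising_S; ring.
Qed.

(** * Euler's constant as a limit of integrals *)

Lemma ex_RInt_unit (f : R -> R) :
  (forall u, 0 <= u <= 1 -> continuous f u) -> ex_RInt f 0 1.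
Proof.
  intros H; apply (ex_RInt_continuous (V := R_CompleteNormedModule)); intros u.
  rewrite Rmin_left, Rmax_right by lra; apply H.
Qed.

Lemma continuous_pow (n : nat) (u : R) : continuous (fun u => u ^ n) u.
Proof. apply (ex_derive_continuous (fun u => u ^ n)); auto_derive; exact I. Qed.

Lemma RInt_pow (e : nat) : RInt (fun u => u ^ e) 0 1 = / INR (S e).
Proof.
  pose proof (not_0_INR (S e) ltac:(lia)) as H.
  replace (/ INR (S e)) with (minus ((fun u => u ^ S e / INR (S e)) 1)
    ((fun u => u ^ S e / INR (S e)) 0)).
  2:{ unfold minus, plus, opp; simpl; rewrite pow1; field; exact H. }
  apply is_RInt_unique,
    (is_RInt_derive (V := R_CompleteNormedModule) (fun u => u ^ S e / INR (S e))).
  - intros u _; auto_derive; [exact I|]; simpl pred; field; exact H.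
  - intros u _; apply continuous_pow.
Qed.

(** The difference of the two sides vanishes at 0 and has derivative x^2 / ((1+x) (2+x)^2). *)
Lemma ln_ge_pade (x : R) : 0 <= x -> 2 * x / (2 + x) <= ln (1 + x).
Proof.
  intros Hx.
  destruct (MVT_gen (fun x => ln (1 + x) - 2 * x / (2 + x)) 0 x
    (fun x => x ^ 2 / ((1 + x) * (2 + x) ^ 2))) as [c [Hc E]].
  - intros y; rewrite Rmin_left, Rmax_right by lra; intros Hy.
    auto_derive; [lra|]; field; lra.
  - intros y; rewrite Rmin_left, Rmax_right by lra; intros Hy.
    apply derivable_continuous_pt, ex_derive_Reals_0.
    auto_derive; lra.
  - rewrite Rmin_left, Rmax_right in Hc by lra.
    rewrite Rplus_0_r, ln_1 in E.
    assert (0 <= c ^ 2 / ((1 + c) * (2 + c) ^ 2) * (x - 0)).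
    { apply Rmult_le_pos; [|lra]; apply Rle_div_r; nra. }
    lra.
Qed.

Lemma ln_succ_bounds (a : R) : 0 < a ->
  / (a + 1) <= ln ((a + 1) / a) <= / a /\ 2 / (2 * a + 1) <= ln ((a + 1) / a).
Proof.
  intros Ha.
  pose proof (Rinv_0_lt_compat a Ha).
  replace ((a + 1) / a) with (1 + / a) by (field; lra).
  pose proof (ln_ge_pade (/ a) ltac:(lra)) as H1.
  replace (2 * / a / (2 + / a)) with (2 / (2 * a + 1)) in H1 by (field; lra).
  assert (/ (a + 1) <= 2 / (2 * a + 1)).
  { apply Rle_div_r; [lra|]; rewrite Rmult_comm; apply Rle_div_l; lra. }
  pose proof (exp_ineq1_le (/ a)) as H2.
  apply (ln_le (1 + / a)) in H2; [|lra]; rewrite ln_exp in H2; lra.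
Qed.

Lemma S_succ (n : nat) :
  S_ (S n) - S_ n = / INR (S n) - ln ((INR (S n) + 1) / INR (S n)).
Proof.
  unfold S_, harmonic; rewrite sum_n_Sm by lia.
  pose proof (lt_0_INR (S n) ltac:(lia)); pose proof (lt_0_INR (S (S n)) ltac:(lia)).
  rewrite ln_div, <- (S_INR n) by lra.
  change (plus ?s ?t) with (s + t); lra.
Qed.

Lemma S_0 : S_ 0 = 0.
Proof.
  unfold S_, harmonic; rewrite sum_n_m_zero by lia; simpl.
  rewrite Rplus_0_l, ln_1; unfold zero; simpl; ring.
Qed.

Lemma S_incr n : S_ n <= S_ (S n).
Proof.
  pose proof (S_succ n) as E; pose proof (lt_0_INR (S n) ltac:(lia)) as H.
  pose proof (ln_succ_bounds _ H); lra.
Qed.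

(* The correction term telescopes because
   1/j - 2/(2j+1) <= 1/(2 (j-1/4) (j+3/4)). *)
Lemma S_le_telescope n : S_ n + / (2 * (INR n + 3 / 4)) <= 2 / 3.
Proof.
  induction n as [|n IH].
  (* Equality at n = 0: the constant 2/3 is the value 1/(2 * 3/4) of the correction term. *)
  - rewrite S_0; simpl; lra.
  - pose proof (S_succ n) as E; pose proof (lt_0_INR (S n) ltac:(lia)) as H.
    destruct (ln_succ_bounds _ H) as [_ H1].
    rewrite S_INR in *; pose proof (pos_INR n) as Hn.
    set (t := INR n) in *.
    assert (/ (t + 1) - 2 / (2 * (t + 1) + 1)
            <= / (2 * (t + 3 / 4)) - / (2 * (t + 1 + 3 / 4))).
    { apply Rminus_le_0.
      replace (_ - _) with (3 / 16 / (2 * (t + 3/4) * (t + 7/4) * (t+1) * (t+3/2)) * 1).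
      2:{ field; repeat split; lra. }
      rewrite Rmult_1_r; apply Rdiv_le_0_compat; [lra|].
      repeat apply Rmult_lt_0_compat; lra. }
    lra.
Qed.

Lemma is_lim_seq_S : is_lim_seq S_ euler_gamma.
Proof.
  destruct (ex_finite_lim_seq_incr S_ (2 / 3) S_incr) as [l Hl].
  { intros n; pose proof (S_le_telescope n); pose proof (pos_INR n).
    assert (0 < / (2 * (INR n + 3 / 4))) by (apply Rinv_0_lt_compat; lra); lra. }
  replace euler_gamma with l; [exact Hl|].
  unfold euler_gamma.
  rewrite (is_lim_seq_unique _ l); [reflexivity|].
  (* The shift to n + 1 skips the junk value of ln at 0. *)
  apply is_lim_seq_incr_1.
  apply (is_lim_seq_ext (fun n => S_ (S n) + ln ((INR (S n) + 1) / INR (S n)))).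
  { intros n; unfold S_; pose proof (lt_0_INR (S n) ltac:(lia)).
    rewrite ln_div; lra. }
  replace (Finite l) with (Rbar_plus l 0) by (simpl; f_equal; ring).
  apply is_lim_seq_plus'.
  - apply (is_lim_seq_incr_1 S_), Hl.
  - apply (is_lim_seq_le_le (fun _ => 0) _ (fun n => / INR (S n))).
    + intros n; pose proof (lt_0_INR (S n) ltac:(lia)) as H.
      destruct (ln_succ_bounds _ H) as [H1 _].
      assert (0 < / (INR (S n) + 1)) by (apply Rinv_0_lt_compat; lra); lra.
    + apply is_lim_seq_const.
    + apply (is_lim_seq_incr_1 (fun n => / INR n)).
      replace (Finite 0) with (Rbar_inv p_infty) by reflexivity.
      apply is_lim_seq_inv; [apply is_lim_seq_INR|discriminate].
Qed.

Lemma euler_gamma_le : euler_gamma <= 2 / 3.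
Proof.
  refine (is_lim_seq_le S_ (fun _ => 2 / 3) euler_gamma (2 / 3) _ is_lim_seq_S
            (is_lim_seq_const _)).
  intros n; pose proof (S_le_telescope n); pose proof (pos_INR n).
  assert (0 < / (2 * (INR n + 3 / 4))) by (apply Rinv_0_lt_compat; lra); lra.
Qed.

(* Converges on [0, 1] to 1/(1-u) + 1/ln u, whose moments are [euler_gamma - S_ e],
   because this limit w satisfies w(u) = 1/2 / (1 + sqrt u) + 1/2 w(sqrt u). *)
Fixpoint gamma_weight (K : nat) (u : R) : R :=
  match K with
  | O => 0
  | S K' => / 2 * / (sqrt u + 1) + / 2 * gamma_weight K' (sqrt u)
  end.

Lemma continuous_gamma_weight K u : continuous (gamma_weight K) u.
Proof.
  revert u; induction K as [|K IH]; intros u; [apply continuous_const|].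
  simpl.
  apply (continuous_plus (fun u => / 2 * / (sqrt u + 1))
                         (fun u => / 2 * gamma_weight K (sqrt u))).
  - apply (continuous_scal_r (/ 2) (fun u => / (sqrt u + 1))).
    apply (continuous_comp (fun u => sqrt u + 1) Rinv).
    + apply (continuous_plus sqrt (fun _ => 1)); [apply continuous_sqrt|apply continuous_const].
    + apply continuous_Rinv; pose proof (sqrt_pos u); lra.
  - apply (continuous_scal_r (/ 2) (fun u => gamma_weight K (sqrt u))).
    apply (continuous_comp sqrt); [apply continuous_sqrt|apply IH].
Qed.

Lemma gamma_weight_bounds K u : 0 <= gamma_weight K u <= 1.
Proof.
  revert u; induction K as [|K IH]; intros u; simpl; [lra|].
  specialize (IH (sqrt u)); pose proof (sqrt_pos u).
  assert (0 < / (sqrt u + 1) <= 1); [|lra].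
  split; [apply Rinv_0_lt_compat; lra|].
  rewrite <- Rinv_1; apply Rinv_le_contravar; lra.
Qed.

Definition gamma_moment (K e : nat) : R :=
  RInt (fun u => u ^ e * gamma_weight K u) 0 1.

Lemma continuous_gamma_integrand K e u :
  continuous (fun u => u ^ e * gamma_weight K u) u.
Proof.
  apply (continuous_mult (fun u => u ^ e) (gamma_weight K));
    [apply continuous_pow|apply continuous_gamma_weight].
Qed.

Lemma gamma_moment_bounds K e : 0 <= gamma_moment K e <= / INR (S e).
Proof.
  unfold gamma_moment; rewrite <- RInt_pow.
  assert (H : ex_RInt (fun u => u ^ e * gamma_weight K u) 0 1)
    by (apply ex_RInt_unit; intros; apply continuous_gamma_integrand).
  split.
  - apply RInt_ge_0; [lra|exact H|].
    intros u Hu; pose proof (gamma_weight_bounds K u).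
    apply Rmult_le_pos; [apply pow_le|]; lra.
  - apply RInt_le; [lra|exact H|apply ex_RInt_unit; intros; apply continuous_pow|].
    intros u Hu; pose proof (gamma_weight_bounds K u).
    rewrite <- (Rmult_1_r (u ^ e)) at 2.
    apply Rmult_le_compat_l; [apply pow_le|]; lra.
Qed.

(** Euler's constant cancels between consecutive moments, so the drops can be compared with the
    explicit increments of [S_]. *)
Definition gamma_moment_drop (K e : nat) : R :=
  gamma_moment K e - gamma_moment K (S e).

(** Substitution u = v^2: the Jacobian 2 v cancels the factors 1/2 and turns the exponent 2e into 2e
    + 1. *)
Lemma gamma_moment_S K e :
  gamma_moment (S K) e
  = RInt (fun v => v ^ (2 * e + 1) * / (v + 1)) 0 1 + gamma_moment K (2 * e + 1).
Proof.
  unfold gamma_moment.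
  assert (E : RInt (fun u => u ^ e * gamma_weight (S K) u) (0 ^ 2) (1 ^ 2)
    = RInt (fun v => scal (2 * v) ((v ^ 2) ^ e * gamma_weight (S K) (v ^ 2))) 0 1).
  { symmetry; apply (RInt_comp (fun u => u ^ e * gamma_weight (S K) u) (fun v => v ^ 2)).
    - intros; apply continuous_gamma_integrand.
    - intros v _; split; [auto_derive; [exact I|simpl; ring]|].
      apply (ex_derive_continuous (fun v => 2 * v)); auto_derive; exact I. }
  replace (0 ^ 2) with 0 in E by ring; replace (1 ^ 2) with 1 in E by ring.
  rewrite E.
  rewrite <- (RInt_plus (V := R_CompleteNormedModule)).
  - apply RInt_ext; intros v; rewrite Rmin_left, Rmax_right by lra; intros Hv.
    unfold scal, plus; simpl; unfold mult; simpl.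
    rewrite Rmult_1_r, sqrt_square by lra.
    replace (e + (e + 0) + 1)%nat with (S (e + e)) by lia.
    rewrite Rpow_mult_distr; simpl; rewrite pow_add; field; lra.
  - apply ex_RInt_unit; intros v Hv.
    apply (ex_derive_continuous (fun v => v ^ (2 * e + 1) * / (v + 1))); auto_derive; lra.
  - apply ex_RInt_unit; intros; apply continuous_gamma_integrand.
Qed.

Lemma gamma_moment_drop_S K e :
  gamma_moment_drop (S K) e
  = / INR (2 * e + 2) - / INR (2 * e + 3)
    + gamma_moment_drop K (2 * e + 1) + gamma_moment_drop K (2 * e + 2).
Proof.
  unfold gamma_moment_drop; rewrite !gamma_moment_S.
  replace (S (2 * e + 1)) with (2 * e + 2)%nat by lia.
  replace (S (2 * e + 2)) with (2 * S e + 1)%nat by lia.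
  (* The denominator disappears because v^(2e+1) (1 - v^2) / (1 + v) = v^(2e+1) - v^(2e+2). *)
  assert (E : RInt (fun v => v ^ (2 * e + 1) * / (v + 1)) 0 1
    - RInt (fun v => v ^ (2 * S e + 1) * / (v + 1)) 0 1
    = / INR (2 * e + 2) - / INR (2 * e + 3)).
  { replace (2 * e + 2)%nat with (S (2 * e + 1)) by lia.
    replace (2 * e + 3)%nat with (S (2 * e + 2)) by lia.
    rewrite <- !RInt_pow.
    assert (Hc : forall k, ex_RInt (fun v => v ^ k * / (v + 1)) 0 1).
    { intros k; apply ex_RInt_unit; intros v Hv.
      apply (ex_derive_continuous (fun v => v ^ k * / (v + 1))); auto_derive; lra. }
    assert (Hp : forall k, ex_RInt (fun v => v ^ k) 0 1)
      by (intros k; apply ex_RInt_unit; intros; apply continuous_pow).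
    rewrite <- !(RInt_minus (V := R_CompleteNormedModule)) by auto.
    apply RInt_ext; intros v; rewrite Rmin_left, Rmax_right by lra; intros Hv.
    replace (2 * S e + 1)%nat with (S (S (2 * e + 1))) by lia.
    replace (2 * e + 2)%nat with (S (2 * e + 1)) by lia.
    unfold minus, plus, opp; simpl; field; lra. }
  lra.
Qed.

(** With a = e + 1, the increment d(a) = 1/a - ln((a+1)/a) satisfies d(a) = 1/(2a) - 1/(2a+1) +
    d(2a) + d(2a+1), the recurrence of [gamma_moment_drop_S]. The errors at 2a and 2a + 1 telescope
    to half of the bound for K at a. *)
Lemma gamma_moment_drop_approx K e :
  0 <= S_ (S e) - S_ e - gamma_moment_drop K e
    <= (/ 2) ^ K * (/ INR (S e) - / INR (S (S e))).
Proof.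
  rewrite S_succ.
  revert e; induction K as [|K IH]; intros e.
  - pose proof (lt_0_INR (S e) ltac:(lia)) as H; rewrite (S_INR (S e)).
    pose proof (ln_succ_bounds _ H) as [H1 _].
    unfold gamma_moment_drop, gamma_moment; simpl gamma_weight.
    assert (E : forall k, RInt (fun u => u ^ k * 0) 0 1 = 0).
    { intros k; rewrite (RInt_ext _ (fun _ => 0)), RInt_const by (intros; apply Rmult_0_r).
      unfold scal; simpl; unfold mult; simpl; ring. }
    rewrite !E, pow_O; lra.
  - pose proof (IH (2 * e + 1)%nat) as H1; pose proof (IH (2 * e + 2)%nat) as H2.
    rewrite gamma_moment_drop_S.
    assert (Ha : 0 < INR (S e)) by (apply lt_0_INR; lia).
    set (a := INR (S e)) in *.
    replace (INR (S (2 * e + 1))) with (2 * a) in *.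
    2:{ unfold a; rewrite !S_INR, plus_INR, mult_INR; simpl; ring. }
    replace (INR (S (S (2 * e + 1)))) with (2 * a + 1) in *.
    2:{ unfold a; rewrite !S_INR, plus_INR, mult_INR; simpl; ring. }
    replace (INR (S (2 * e + 2))) with (2 * a + 1) in *.
    2:{ unfold a; rewrite !S_INR, plus_INR, mult_INR; simpl; ring. }
    replace (INR (S (S (2 * e + 2)))) with (2 * a + 2) in *.
    2:{ unfold a; rewrite !S_INR, plus_INR, mult_INR; simpl; ring. }
    replace (INR (2 * e + 2)) with (2 * a).
    2:{ unfold a; rewrite !S_INR, plus_INR, mult_INR; simpl; ring. }
    replace (INR (2 * e + 3)) with (2 * a + 1).
    2:{ unfold a; rewrite !S_INR, plus_INR, mult_INR; simpl; ring. }
    replace (INR (S (S e))) with (a + 1) by (unfold a; rewrite !S_INR; ring).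
    replace (2 * a + 1 + 1) with (2 * a + 2) in * by ring.
    assert (Eln : ln ((a + 1) / a)
      = ln ((2 * a + 1) / (2 * a)) + ln ((2 * a + 2) / (2 * a + 1))).
    { rewrite <- ln_mult by (apply Rdiv_lt_0_compat; lra).
      f_equal; field; lra. }
    rewrite Eln.
    replace ((/ 2) ^ S K * (/ a - / (a + 1)))
      with ((/ 2) ^ K * (/ (2 * a) - / (2 * a + 1))
            + (/ 2) ^ K * (/ (2 * a + 1) - / (2 * a + 2)))
      by (simpl; field; lra).
    replace (/ a) with (/ (2 * a) + / (2 * a)) by (field; lra).
    lra.
Qed.

(** The drops are summed from e up to e + d. As d grows, the moment at e + d tends to 0 and
    [S_ (e + d)] to [euler_gamma], which is how the constant enters. *)
Lemma gamma_moment_approx K e :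
  euler_gamma - S_ e - (/ 2) ^ K * / INR (S e)
  <= gamma_moment K e <= euler_gamma - S_ e.
Proof.
  assert (H : forall d, 0 <= gamma_moment K (e + d) + S_ (e + d)
      - (gamma_moment K e + S_ e)
      <= (/ 2) ^ K * (/ INR (S e) - / INR (S (e + d)))).
  { induction d as [|d IH].
    - rewrite Nat.add_0_r, !Rminus_diag, Rmult_0_r; lra.
    - rewrite Nat.add_succ_r.
      pose proof (gamma_moment_drop_approx K (e + d)) as H.
      unfold gamma_moment_drop in H; lra. }
  assert (L : is_lim_seq
      (fun d => gamma_moment K (e + d) + S_ (e + d) - (gamma_moment K e + S_ e))
      (0 + euler_gamma - (gamma_moment K e + S_ e))).
  { apply is_lim_seq_minus'; [|apply is_lim_seq_const].
    apply is_lim_seq_plus'.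
    - apply (is_lim_seq_ext (fun d => gamma_moment K (d + e)));
        [intros; f_equal; lia|].
      apply (is_lim_seq_incr_n (gamma_moment K)).
      apply (is_lim_seq_le_le (fun _ => 0) _ (fun n => / INR (S n)));
        [apply gamma_moment_bounds|apply is_lim_seq_const|].
      apply (is_lim_seq_incr_1 (fun n => / INR n)).
      replace (Finite 0) with (Rbar_inv p_infty) by reflexivity.
      apply is_lim_seq_inv; [apply is_lim_seq_INR|discriminate].
    - apply (is_lim_seq_ext (fun d => S_ (d + e))); [intros; f_equal; lia|].
      apply (is_lim_seq_incr_n S_), is_lim_seq_S. }
  assert (Hp : 0 < (/ 2) ^ K) by (apply pow_lt; lra).
  pose proof (is_lim_seq_le _ _ _ _ (fun d => proj1 (H d))
    (is_lim_seq_const 0) L) as L1.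
  assert (L2 : Rbar_le (0 + euler_gamma - (gamma_moment K e + S_ e))
                 ((/ 2) ^ K * / INR (S e))).
  { refine (is_lim_seq_le _ (fun _ => (/ 2) ^ K * / INR (S e)) _ _ _ L
              (is_lim_seq_const _)).
    intros d; apply Rle_trans with (1 := proj2 (H d)).
    apply Rmult_le_compat_l; [lra|].
    assert (0 < / INR (S (e + d))) by (apply Rinv_0_lt_compat, lt_0_INR; lia); lra. }
  unfold Rbar_le in L1, L2; lra.
Qed.

(** * Stieltjes functions *)

(* Uniform limits on [0, 1] of finite sums of a / (u + x) with a >= 0 and x > 0. *)
Inductive stieltjes : (R -> R) -> Prop :=
| stieltjes_pole (x : R) : 0 < x -> stieltjes (fun u => / (u + x))
| stieltjes_zero : stieltjes (fun _ => 0)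
| stieltjes_comb (a : R) (f g : R -> R) :
    0 <= a -> stieltjes f -> stieltjes g -> stieltjes (fun u => a * f u + g u)
| stieltjes_lim (f : R -> R) (g : nat -> R -> R) :
    (forall u, 0 <= u <= 1 -> continuous f u) ->
    (forall n, stieltjes (g n)) ->
    (forall n u, 0 <= u <= 1 -> Rabs (f u - g n u) <= / INR (S n)) ->
    stieltjes f.

Lemma continuous_pole x u : 0 < u + x -> continuous (fun u => / (u + x)) u.
Proof.
  intros H; apply (ex_derive_continuous (fun u => / (u + x))); auto_derive; lra.
Qed.

Lemma stieltjes_continuous f u :
  stieltjes f -> 0 <= u <= 1 -> continuous f u.
Proof.
  intros H Hu; revert u Hu; induction H as [x Hx| |a f g Ha Hf IHf Hg IHg|f g Hf]; intros u Hu.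
  - apply continuous_pole; lra.
  - apply continuous_const.
  - apply (continuous_plus (fun u => a * f u) g); [|now apply IHg].
    apply (continuous_scal_r a f), IHf, Hu.
  - now apply Hf.
Qed.

(* 1/(v+x) is 2/PI times the integral of this kernel over [0, PI/2].  The kernel is
   increasing in s, so its Riemann sums converge uniformly in v; with v = sqrt u they are
   sums of poles in u, located at -(x tan s)^2. *)
Definition sqrt_kernel (x v s : R) : R :=
  x * sin s ^ 2 / (x ^ 2 * sin s ^ 2 + v ^ 2 * cos s ^ 2).

Lemma sin2_cos2_pow s : sin s ^ 2 + cos s ^ 2 = 1.
Proof. pose proof (sin2_cos2 s) as H; unfold Rsqr in H; lra. Qed.

Lemma sqrt_kernel_denom_pos x v s : 0 < x -> 0 < v ->
  0 < x ^ 2 * sin s ^ 2 + v ^ 2 * cos s ^ 2.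
Proof.
  intros Hx Hv; pose proof (sin2_cos2_pow s).
  assert (0 < x ^ 2) by (apply pow_lt; lra).
  assert (0 < v ^ 2) by (apply pow_lt; lra).
  pose proof (pow2_ge_0 (sin s)); pose proof (pow2_ge_0 (cos s)).
  destruct (Req_dec (sin s ^ 2) 0) as [E|E]; nra.
Qed.

Lemma sqrt_kernel_incr x v s t : 0 < x -> 0 < v ->
  0 <= s -> s <= t -> t <= PI / 2 -> sqrt_kernel x v s <= sqrt_kernel x v t.
Proof.
  intros Hx Hv Hs Hst Ht; unfold sqrt_kernel.
  pose proof (sqrt_kernel_denom_pos x v s Hx Hv) as H1.
  pose proof (sqrt_kernel_denom_pos x v t Hx Hv) as H2.
  assert (Hsin : 0 <= sin s <= sin t).
  { pose proof PI_RGT_0; split; [apply sin_ge_0; lra|apply sin_incr_1; lra]. }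
  pose proof (sin2_cos2_pow s) as E1; pose proof (sin2_cos2_pow t) as E2.
  assert (Hq : sin s ^ 2 <= sin t ^ 2) by (apply pow_incr; lra).
  apply Rminus_le_0.
  rewrite Rdiv_minus by lra.
  apply Rdiv_le_0_compat; [|now apply Rmult_lt_0_compat].
  replace (cos s ^ 2) with (1 - sin s ^ 2) by lra.
  replace (cos t ^ 2) with (1 - sin t ^ 2) by lra.
  replace (_ - _) with (x * v ^ 2 * (sin t ^ 2 - sin s ^ 2)) by ring.
  apply Rmult_le_pos; [|lra].
  apply Rmult_le_pos; [lra|apply pow2_ge_0].
Qed.

(* In the generic case the second term is the angle of (v cos s, x sin s) minus s,
   written without the singularity of tan at PI/2. *)
Lemma sqrt_kernel_primitive x v : 0 < x -> 0 < v ->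
  exists F, F 0 = 0 /\ F (PI / 2) = PI / 2 / (x + v) /\
    forall s, is_derive F s (sqrt_kernel x v s).
Proof.
  intros Hx Hv.
  (* At x = v the coefficient v/(x^2 - v^2) of the generic primitive is singular; the kernel is then
     sin^2 s / x. *)
  destruct (Req_dec x v) as [<-|Hxv].
  - exists (fun s => (s - sin s * cos s) / (2 * x)); split; [|split].
    + rewrite sin_0; field; lra.
    + rewrite cos_PI2; field; lra.
    + intros s; unfold sqrt_kernel; auto_derive; [lra|].
      rewrite <- Rmult_plus_distr_l, sin2_cos2_pow.
      pose proof (sin2_cos2_pow s) as E.
      replace 1 with (sin s ^ 2 + cos s ^ 2) at 1 by exact E.
      field; lra.
  - exists (fun s => s / (x + v) - v / (x ^ 2 - v ^ 2)
      * atan ((x - v) * sin s * cos s / (v * cos s ^ 2 + x * sin s ^ 2))).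
    assert (Hxv2 : x ^ 2 - v ^ 2 <> 0).
    { replace (x ^ 2 - v ^ 2) with ((x - v) * (x + v)) by ring.
      apply Rmult_integral_contrapositive; lra. }
    split; [|split].
    + rewrite sin_0; unfold Rdiv; rewrite !Rmult_0_r, !Rmult_0_l, atan_0; ring.
    + rewrite cos_PI2; unfold Rdiv; rewrite !Rmult_0_r, !Rmult_0_l, atan_0; ring.
    + intros s; unfold sqrt_kernel.
      pose proof (sqrt_kernel_denom_pos x v s Hx Hv) as HQ.
      assert (HD : 0 < v * cos s ^ 2 + x * sin s ^ 2).
      { pose proof (sin2_cos2_pow s).
        pose proof (pow2_ge_0 (sin s)); pose proof (pow2_ge_0 (cos s)).
        destruct (Req_dec (sin s ^ 2) 0) as [E|E]; nra. }
      auto_derive; [lra|].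
      pose proof (sin2_cos2_pow s) as E.
      set (c := cos s) in *; set (z := sin s) in *; clearbody c z.
      (* The squared modulus of (v c + i x z)(c - i z), whose argument is the angle in the
         primitive. *)
      assert (EN : (v * c ^ 2 + x * z ^ 2) ^ 2 + ((x - v) * z * c) ^ 2
                   = x ^ 2 * z ^ 2 + v ^ 2 * c ^ 2).
      { rewrite <- (Rmult_1_r (x ^ 2 * z ^ 2 + v ^ 2 * c ^ 2)), <- E; ring. }
      transitivity (/ (x + v) - v / (x ^ 2 - v ^ 2)
        * (((x - v) * (c ^ 2 - z ^ 2) * (v * c ^ 2 + x * z ^ 2)
            - 2 * (x - v) ^ 2 * z ^ 2 * c ^ 2)
           / ((v * c ^ 2 + x * z ^ 2) ^ 2 + ((x - v) * z * c) ^ 2))).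
      { field; repeat split; lra. }
      rewrite EN.
      replace ((x - v) * (c ^ 2 - z ^ 2) * (v * c ^ 2 + x * z ^ 2)
            - 2 * (x - v) ^ 2 * z ^ 2 * c ^ 2)
        with (x * v * (z ^ 2 + c ^ 2) ^ 2
              - (x ^ 2 * z ^ 2 + v ^ 2 * c ^ 2) * (z ^ 2 + c ^ 2)) by ring.
      replace (c ^ 2) with (1 - z ^ 2) in * by lra.
      field; repeat split; lra.
Qed.

(** The upper and lower sums differ by the telescoping h (phi L - phi 0). Only values at the nodes
    enter, so the case v = 0, where the kernel jumps, is covered too. *)
Lemma monotone_riemann_error (F phi : nat -> R) (h : R) (L : nat) :
  (forall i, (i < L)%nat -> h * phi i <= F (S i) - F i <= h * phi (S i)) ->
  F 0%nat + h * sum_n_m phi 1 L - h * (phi L - phi 0%nat) <= F L <= F 0%nat + h * sum_n_m phi 1 L.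
Proof.
  induction L as [|L IH]; intros H.
  - rewrite sum_n_m_zero by lia; unfold zero; simpl; lra.
  - rewrite sum_n_Sm by lia; change (plus ?s ?t) with (s + t).
    specialize (H L ltac:(lia)) as HL.
    assert (IH' := IH ltac:(intros i Hi; apply H; lia)); lra.
Qed.

(** Right endpoints; the normalisation 2/PI times the mesh PI/2/L leaves 1/L. *)
Definition riemann_sqrt (x : R) (L : nat) (v : R) : R :=
  / INR L * sum_n_m (fun i => sqrt_kernel x v (PI / 2 * (INR i / INR L))) 1 L.

Lemma riemann_sqrt_error x v L : 0 < x -> 0 <= v -> (0 < L)%nat ->
  Rabs (/ (v + x) - riemann_sqrt x L v) <= / (INR L * x).
Proof.
  intros Hx Hv HL; pose proof (lt_0_INR L HL) as HL'.
  pose proof PI_RGT_0 as Hpi.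
  assert (Hend : sqrt_kernel x v (PI / 2) = / x).
  { unfold sqrt_kernel; rewrite sin_PI2, cos_PI2; field; lra. }
  assert (Hstart : sqrt_kernel x v 0 = 0).
  { unfold sqrt_kernel; rewrite sin_0; unfold Rdiv; ring. }
  set (s := fun i => PI / 2 * (INR i / INR L)).
  assert (Hs : forall i, s (S i) = s i + PI / 2 / INR L).
  { intros i; unfold s; rewrite S_INR; field; lra. }
  assert (Hstep : 0 < PI / 2 / INR L) by (apply Rdiv_lt_0_compat; lra).
  assert (HsL : s L = PI / 2) by (unfold s; field; lra).
  assert (Hs0 : s 0%nat = 0) by (unfold s; simpl; field; lra).
  assert (Hrange : forall i, (i <= L)%nat -> 0 <= s i <= PI / 2).
  { intros i Hi; unfold s; pose proof (pos_INR i); apply le_INR in Hi.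
    assert (0 <= INR i / INR L <= 1); [|nra].
    split; [apply Rdiv_le_0_compat; lra|apply Rle_div_l; lra]. }
  assert (HF : exists F, F 0 = 0 /\ F (PI / 2) = PI / 2 / (x + v) /\
    forall i, (i < L)%nat ->
      PI / 2 / INR L * sqrt_kernel x v (s i) <= F (s (S i)) - F (s i)
        <= PI / 2 / INR L * sqrt_kernel x v (s (S i))).
  (* At v = 0 the kernel is 1/x wherever sin does not vanish, and 0 at s = 0 by the convention on
     division by zero. The function t/x then takes the role of the primitive. *)
  { destruct (Req_dec v 0) as [->|Hv0].
    - exists (fun t => t / x); split; [field; lra|split; [field; lra|]].
      assert (Hk : forall t, sqrt_kernel x 0 t <= / x).
      { intros t; unfold sqrt_kernel; rewrite pow_i, Rmult_0_l, Rplus_0_r by lia.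
        destruct (Req_dec (sin t) 0) as [->|Ht].
        - unfold Rdiv; rewrite pow_i, !Rmult_0_r, Rmult_0_l by lia.
          apply Rlt_le, Rinv_0_lt_compat; lra.
        - apply Req_le; field; split; lra. }
      intros i Hi; rewrite Hs.
      replace ((s i + PI / 2 / INR L) / x - s i / x) with (PI / 2 / INR L * / x)
        by (field; lra).
      split; [apply Rmult_le_compat_l; [lra|apply Hk]|].
      apply Req_le; f_equal; rewrite <- Hs.
      assert (0 < s (S i)) by (specialize (Hrange i ltac:(lia)); rewrite Hs; lra).
      assert (0 < sin (s (S i))).
      { apply sin_gt_0; [lra|specialize (Hrange (S i) ltac:(lia)); lra]. }
      unfold sqrt_kernel; field; split; lra.
    - destruct (sqrt_kernel_primitive x v Hx ltac:(lra)) as [F [F0 [F1 HF]]].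
      exists F; split; [exact F0|split; [exact F1|]].
      intros i Hi.
      destruct (MVT_gen F (s i) (s (S i)) (sqrt_kernel x v)) as [c [Hc ->]].
      + intros; apply HF.
      + intros t _; apply derivable_continuous_pt, ex_derive_Reals_0.
        eexists; apply HF.
      + pose proof (Hrange i ltac:(lia)); pose proof (Hrange (S i) ltac:(lia)).
        rewrite Hs in Hc |- *; rewrite Hs in H0.
        rewrite Rmin_left, Rmax_right in Hc by lra.
        replace (s i + PI / 2 / INR L - s i) with (PI / 2 / INR L) by ring.
        rewrite (Rmult_comm (sqrt_kernel x v c)).
        split; (apply Rmult_le_compat_l; [lra|apply sqrt_kernel_incr; lra]). }
  destruct HF as [F [F0 [F1 HF]]].
  pose proof (monotone_riemann_error (fun i => F (s i))
    (fun i => sqrt_kernel x v (s i)) (PI / 2 / INR L) L HF) as H.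
  cbv beta in H; rewrite HsL, Hs0, F0, F1, Hend, Hstart in H.
  unfold riemann_sqrt; fold s.
  change (fun i : nat => sqrt_kernel x v (PI / 2 * (INR i / INR L)))
    with (fun i : nat => sqrt_kernel x v (s i)).
  set (sigma := sum_n_m _ _ _) in *.
  assert (H' : - (/ (INR L * x)) <= / (v + x) - / INR L * sigma <= 0).
  { split; (apply (Rmult_le_reg_l (PI / 2)); [lra|]).
    - replace (PI / 2 * - / (INR L * x)) with (- (PI / 2 / INR L * (/ x - 0)))
        by (field; lra).
      replace (PI / 2 * (/ (v + x) - / INR L * sigma))
        with (PI / 2 / (x + v) - PI / 2 / INR L * sigma) by (field; lra).
      lra.
    - replace (PI / 2 * (/ (v + x) - / INR L * sigma))
        with (PI / 2 / (x + v) - PI / 2 / INR L * sigma) by (field; lra).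
      lra. }
  apply Rabs_le; lra.
Qed.

(** A constant approximating sequence in [stieltjes_lim] transfers the property along agreement on
    [0, 1] alone, without functional extensionality. *)
Lemma stieltjes_ext f g : (forall u, 0 <= u <= 1 -> f u = g u) ->
  (forall u, 0 <= u <= 1 -> continuous g u) -> stieltjes f -> stieltjes g.
Proof.
  intros E Hg Hf; apply (stieltjes_lim g (fun _ => f)); [exact Hg|auto|].
  intros n u Hu; rewrite E, Rminus_diag, Rabs_R0 by exact Hu.
  apply Rlt_le, Rinv_0_lt_compat, lt_0_INR; lia.
Qed.

(** A pole receding to infinity: a X / (u + X) tends to a. The choice X = (1 + a)(n + 1) makes the
    error a u / (u + X) at most 1/(n + 1). *)
Lemma stieltjes_const a : 0 <= a -> stieltjes (fun _ => a).
Proof.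
  intros Ha.
  apply (stieltjes_lim _ (fun n u =>
    a * (1 + a) * INR (S n) * / (u + (1 + a) * INR (S n)) + 0)).
  - intros; apply continuous_const.
  - intros n; pose proof (lt_0_INR (S n) ltac:(lia)).
    apply (stieltjes_comb _ (fun u => / (u + (1 + a) * INR (S n))) (fun _ => 0)).
    + repeat apply Rmult_le_pos; lra.
    + constructor; nra.
    + constructor.
  - intros n u Hu; pose proof (lt_0_INR (S n) ltac:(lia)) as Hn.
    set (t := INR (S n)) in *.
    assert (Hd : 0 < u + (1 + a) * t) by nra.
    replace (a - _) with (a * u / (u + (1 + a) * t)) by (field; lra).
    rewrite Rabs_pos_eq by (apply Rdiv_le_0_compat; nra).
    apply Rle_div_l; [exact Hd|].
    apply (Rmult_le_reg_l t); [exact Hn|].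
    rewrite <- (Rmult_assoc t (/ t)), Rinv_r by lra; nra.
Qed.

Lemma stieltjes_riemann_sqrt x L : 0 < x -> (0 < L)%nat ->
  exists g, stieltjes g /\
    forall u, 0 <= u <= 1 -> g u = riemann_sqrt x L (sqrt u).
Proof.
  intros Hx HL; pose proof (lt_0_INR L HL) as HL'; pose proof PI_RGT_0 as Hpi.
  assert (H : forall M, (M < L)%nat -> exists g, stieltjes g /\
    forall u, 0 <= u <= 1 -> g u = / INR L
      * sum_n_m (fun i => sqrt_kernel x (sqrt u) (PI / 2 * (INR i / INR L))) 1 M).
  { induction M as [|M IH]; intros HM.
    - exists (fun _ => 0); split; [constructor|].
      intros u _; rewrite sum_n_m_zero by lia; symmetry; apply Rmult_0_r.
    - destruct (IH ltac:(lia)) as [g [Hg E]].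
      set (s := PI / 2 * (INR (S M) / INR L)).
      assert (Hs : 0 < s < PI / 2).
      { apply lt_INR in HM; pose proof (lt_0_INR (S M) ltac:(lia)).
        assert (0 < INR (S M) / INR L < 1); [|unfold s; nra].
        split; [apply Rdiv_lt_0_compat; lra|apply Rlt_div_l; lra]. }
      assert (Hsin : 0 < sin s) by (apply sin_gt_0; lra).
      assert (Hcos : 0 < cos s) by (apply cos_gt_0; lra).
      set (T := sin s ^ 2 / cos s ^ 2).
      assert (HT : 0 < T) by (apply Rdiv_lt_0_compat; apply pow_lt; lra).
      assert (Hx2 : 0 < x ^ 2 * T) by (apply Rmult_lt_0_compat; [apply pow_lt|]; lra).
      exists (fun u => / INR L * (x * T) * / (u + x ^ 2 * T) + g u); split.
      + apply (stieltjes_comb _ (fun u => / (u + x ^ 2 * T)) g);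
          [|constructor; exact Hx2|exact Hg].
        pose proof (Rinv_0_lt_compat _ HL').
        apply Rmult_le_pos; [lra|apply Rmult_le_pos; lra].
      + intros u Hu; rewrite E, sum_n_Sm by (assumption || lia).
        change (plus ?a ?b) with (a + b); rewrite Rmult_plus_distr_l, Rplus_comm.
        f_equal; rewrite Rmult_assoc; f_equal.
        fold s; unfold sqrt_kernel; rewrite pow2_sqrt by lra.
        unfold T in *; field; repeat split; try lra.
        assert (0 < x ^ 2 * sin s ^ 2) by (apply Rmult_lt_0_compat; apply pow_lt; lra).
        assert (0 < cos s ^ 2) by (apply pow_lt; lra); nra. }
  (* At the last node PI/2 the cosine vanishes, and the kernel is the constant 1/x instead of a
     pole. *)
  destruct L as [|L]; [lia|].
  destruct (H L ltac:(lia)) as [g [Hg E]].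
  exists (fun u => 1 * g u + / INR (S L) * / x); split.
  - apply (stieltjes_comb 1 g (fun _ => / INR (S L) * / x)); [lra|exact Hg|].
    apply stieltjes_const, Rmult_le_pos; apply Rlt_le, Rinv_0_lt_compat; lra.
  - intros u Hu; unfold riemann_sqrt; rewrite E, sum_n_Sm by (assumption || lia).
    change (plus ?a ?b) with (a + b); rewrite Rmult_plus_distr_l, Rmult_1_l.
    f_equal; f_equal.
    replace (PI / 2 * (INR (S L) / INR (S L))) with (PI / 2) by (field; lra).
    unfold sqrt_kernel; rewrite sin_PI2, cos_PI2; field; lra.
Qed.

Lemma stieltjes_pole_sqrt x : 0 < x -> stieltjes (fun u => / (sqrt u + x)).
Proof.
  intros Hx.
  (* Since (q + 1) x >= 1, taking (n + 1)(q + 1) nodes brings the Riemann error below 1/(n + 1). *)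
  destruct (nfloor_ex (/ x)) as [q Hq].
  { apply Rlt_le, Rinv_0_lt_compat, Hx. }
  assert (HL : forall n, (0 < S n * S q)%nat) by (intros; lia).
  assert (H : forall n, exists g, stieltjes g /\
    forall u, 0 <= u <= 1 -> g u = riemann_sqrt x (S n * S q) (sqrt u)).
  { intros n; apply stieltjes_riemann_sqrt; [exact Hx|apply HL]. }
  apply functional_choice in H as [g Hg].
  apply (stieltjes_lim _ g).
  - intros u _; apply (continuous_comp sqrt (fun v => / (v + x)));
      [apply continuous_sqrt|].
    apply continuous_pole; pose proof (sqrt_pos u); lra.
  - intros n; apply Hg.
  - intros n u Hu; rewrite (proj2 (Hg n)) by exact Hu.
    apply Rle_trans with (1 := riemann_sqrt_error x (sqrt u) _ Hx (sqrt_pos u) (HL n)).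
    pose proof (lt_0_INR (S n) ltac:(lia)) as Hn.
    apply Rinv_le_contravar; [exact Hn|].
    rewrite mult_INR, (S_INR q), Rmult_assoc.
    rewrite <- (Rmult_1_r (INR (S n))) at 1; apply Rmult_le_compat_l; [lra|].
    assert (H1 : / x * x <= (INR q + 1) * x) by (apply Rmult_le_compat_r; lra).
    rewrite Rinv_l in H1; lra.
Qed.

Lemma stieltjes_comp_sqrt f : stieltjes f -> stieltjes (fun u => f (sqrt u)).
Proof.
  assert (Hsqrt : forall u, 0 <= u <= 1 -> 0 <= sqrt u <= 1).
  { intros u Hu; split; [apply sqrt_pos|].
    rewrite <- sqrt_1; apply sqrt_le_1; lra. }
  induction 1 as [x Hx| |a f g Ha Hf IHf Hg IHg|f g Hf Hg IHg Hfg].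
  - now apply stieltjes_pole_sqrt.
  - constructor.
  - now apply (stieltjes_comb a (fun u => f (sqrt u)) (fun u => g (sqrt u))).
  - apply (stieltjes_lim _ (fun n u => g n (sqrt u))); auto.
    intros u Hu; apply (continuous_comp sqrt f); [apply continuous_sqrt|auto].
Qed.

Lemma stieltjes_gamma_weight K : stieltjes (gamma_weight K).
Proof.
  induction K as [|K IH]; [constructor|].
  apply (stieltjes_comp_sqrt (fun v => / 2 * / (v + 1) + / 2 * gamma_weight K v)).
  apply (stieltjes_comb _ (fun v => / (v + 1))); [lra|constructor; lra|].
  apply (stieltjes_ext (fun v => / 2 * gamma_weight K v + 0)).
  - intros; apply Rplus_0_r.
  - intros; apply (continuous_scal_r (/ 2) (gamma_weight K)), continuous_gamma_weight.
  - apply (stieltjes_comb _ (gamma_weight K) (fun _ => 0)); [lra|exact IH|constructor].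
Qed.

(** * The alternating sum against a pole *)

Lemma RInt_sum_f_R0 (f : nat -> R -> R) (N : nat) :
  (forall k, ex_RInt (f k) 0 1) ->
  ex_RInt (fun u => sum_f_R0 (fun k => f k u) N) 0 1 /\
  RInt (fun u => sum_f_R0 (fun k => f k u) N) 0 1
  = sum_f_R0 (fun k => RInt (f k) 0 1) N.
Proof.
  intros H; induction N as [|N [IH1 IH2]]; simpl; [now split; [apply H|]|].
  split; [now apply (ex_RInt_plus (V := R_NormedModule))|].
  rewrite <- IH2; now apply (RInt_plus (V := R_CompleteNormedModule)).
Qed.

Lemma RInt_scal_R (a : R) (f : R -> R) :
  ex_RInt f 0 1 -> RInt (fun u => a * f u) 0 1 = a * RInt f 0 1.
Proof. intros H; now apply (RInt_scal (V := R_CompleteNormedModule)). Qed.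

Lemma continuous_sum_f_R0 (f : nat -> R -> R) (N : nat) (u : R) :
  (forall k, continuous (f k) u) ->
  continuous (fun u => sum_f_R0 (fun k => f k u) N) u.
Proof.
  intros H; induction N as [|N IH]; [apply H|].
  apply (continuous_plus (fun u => sum_f_R0 (fun k => f k u) N) (f (S N))); auto.
Qed.

Lemma is_lim_seq_sum_f_R0 (f : nat -> nat -> R) (l : nat -> R) (N : nat) :
  (forall k, is_lim_seq (f k) (l k)) ->
  is_lim_seq (fun n => sum_f_R0 (fun k => f k n) N) (sum_f_R0 l N).
Proof.
  intros H; induction N as [|N IH]; [apply H|].
  apply is_lim_seq_plus'; auto.
Qed.

Definition pole_moment (x : R) (l e : nat) : R :=
  RInt (fun u => u ^ e * / (u + x) ^ S l) 0 1.

Lemma ex_RInt_pole_moment x l e :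
  0 < x -> ex_RInt (fun u => u ^ e * / (u + x) ^ S l) 0 1.
Proof.
  intros Hx; apply ex_RInt_unit; intros u Hu.
  apply (ex_derive_continuous (fun u => u ^ e * / (u + x) ^ S l)).
  auto_derive; apply (pow_nonzero (u + x) (S l)); lra.
Qed.

Lemma pole_moment_parts x l e : 0 < x ->
  INR (S e) * pole_moment x l e
  = / (1 + x) ^ S l + INR (S l) * pole_moment x (S l) (S e).
Proof.
  intros Hx; unfold pole_moment.
  assert (E : is_RInt (fun u => INR (S e) * (u ^ e * / (u + x) ^ S l)
                        - INR (S l) * (u ^ S e * / (u + x) ^ S (S l))) 0 1
     (minus ((fun u => u ^ S e * / (u + x) ^ S l) 1)
            ((fun u => u ^ S e * / (u + x) ^ S l) 0))).
  { apply (is_RInt_derive (V := R_CompleteNormedModule)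
             (fun u => u ^ S e * / (u + x) ^ S l)).
    - intros u; rewrite Rmin_left, Rmax_right by lra; intros Hu.
      auto_derive; [apply (pow_nonzero (u + x) (S l)); lra|].
      simpl pred; set (t := INR (S e)); set (s := INR (S l)).
      simpl.
      change (match e with O => 1 | S _ => INR e + 1 end) with t.
      change (match l with O => 1 | S _ => INR l + 1 end) with s.
      field; split; [apply pow_nonzero|]; lra.
    - intros u; rewrite Rmin_left, Rmax_right by lra; intros Hu.
      apply (ex_derive_continuous (fun u => INR (S e) * (u ^ e * / (u + x) ^ S l)
                        - INR (S l) * (u ^ S e * / (u + x) ^ S (S l)))).
      auto_derive; split; [apply (pow_nonzero (u + x) (S l)); lra|].
      split; [apply (pow_nonzero (u + x) (S (S l))); lra|exact I]. }
  apply (is_RInt_unique (V := R_CompleteNormedModule)) in E.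
  rewrite (RInt_minus (V := R_CompleteNormedModule)
    (fun u => INR (S e) * (u ^ e * / (u + x) ^ S l))
    (fun u => INR (S l) * (u ^ S e * / (u + x) ^ S (S l)))) in E.
  2,3: apply (ex_RInt_scal (V := R_NormedModule)), ex_RInt_pole_moment, Hx.
  rewrite !RInt_scal_R in E by now apply ex_RInt_pole_moment.
  rewrite pow1, pow_i, Rmult_0_l, Rmult_1_l in E by lia.
  change (minus ?s ?t) with (s - t) in E.
  rewrite Rminus_0_r in E; rewrite <- E; ring.
Qed.

Lemma pole_moment_0_S x e : 0 < x ->
  pole_moment x 0 (S e) = / INR (S e) - x * pole_moment x 0 e.
Proof.
  intros Hx; unfold pole_moment.
  rewrite <- RInt_pow, <- RInt_scal_R by now apply ex_RInt_pole_moment.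
  rewrite <- (RInt_minus (V := R_CompleteNormedModule)).
  - apply RInt_ext; intros u; rewrite Rmin_left, Rmax_right by lra; intros Hu.
    change (minus ?s ?t) with (s - t); simpl; field; lra.
  - apply ex_RInt_unit; intros; apply continuous_pow.
  - apply (ex_RInt_scal (V := R_NormedModule)), ex_RInt_pole_moment, Hx.
Qed.

Lemma INR_affine r e k : INR (r * k + e) = INR r * INR k + INR e.
Proof. now rewrite plus_INR, mult_INR. Qed.

(* m-fold integration by parts against 1/(u+x)^(l+1); the boundary terms at u = 1
   are vanishing finite differences. *)
Lemma sum_alt_rising_pole_moment x r N d v g m l e :
  0 < x -> const_diff d v g -> (d + m <= N)%nat ->
  sum_f_R0 (fun k => alt_binom N k
    * (g k * rising (INR (r * k + e)) m * pole_moment x l (r * k + e))) N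
  = rising (INR l) m
    * sum_f_R0 (fun k => alt_binom N k
        * (g k * pole_moment x (l + m) (r * k + e + m))) N.
Proof.
  intros Hx Hg; revert l e; induction m as [|m IH]; intros l e Hm.
  - simpl rising; rewrite Rmult_1_l; apply sum_eq; intros k _.
    rewrite !Nat.add_0_r, Rmult_1_r; reflexivity.
  - transitivity (sum_f_R0 (fun k => / (1 + x) ^ S l
         * (alt_binom N k * (rising (INR r * INR k + INR (S e)) m * g k))
      + INR (S l) * (alt_binom N k
          * (g k * rising (INR (r * k + S e)) m * pole_moment x (S l) (r * k + S e)))) N).
    { apply sum_eq; intros k _.
      change (rising (INR (r * k + e)) (S m))
        with ((INR (r * k + e) + 1) * rising (INR (r * k + e) + 1) m).
      rewrite <- INR_affine, Nat.add_succ_r, <- (S_INR (r * k + e)).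
      transitivity (alt_binom N k * g k * rising (INR (S (r * k + e))) m
        * (INR (S (r * k + e)) * pole_moment x l (r * k + e))); [ring|].
      rewrite pole_moment_parts by exact Hx; ring. }
    rewrite sum_plus, !sum_f_R0_scal_l, IH by lia.
    rewrite (sum_alt_binom N 0).
    2:{ apply (const_diff_lt (d + m) _ (rising (INR d) m * INR r ^ m * v)); [lia|].
        now apply const_diff_mul_rising. }
    change (rising (INR l) (S m)) with ((INR l + 1) * rising (INR l + 1) m).
    rewrite <- S_INR, !Rmult_0_r, Rplus_0_l, Rmult_assoc.
    do 2 f_equal; apply sum_eq; intros k _.
    do 3 f_equal; lia.
Qed.

(** Isolates the factor that cancels the denominator 1/(y + i + 1) coming from an integrated
    monomial. *)
Lemma rising_remove y m i : (i < m)%nat ->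
  rising y m = (y + INR (S i)) * (rising y i * rising (y + INR (S i)) (m - S i)).
Proof.
  intros Hi; replace m with (S i + (m - S i))%nat at 1 by lia.
  rewrite rising_add, rising_S; ring.
Qed.

Lemma const_diff_rising r e m :
  const_diff m (INR (fact m) * INR r ^ m) (fun k => rising (INR (r * k + e)) m).
Proof.
  pose proof (const_diff_mul_rising 0 1 (fun _ => 1) (INR r) (INR e) m
    (fun _ => eq_refl)) as H.
  simpl plus in H; rewrite rising_0, Rmult_1_r in H.
  refine (const_diff_ext _ _ _ _ _ H); intros k.
  rewrite INR_affine; apply Rmult_1_r.
Qed.

(** Modulo u + x, the monomial u^q is (-x)^q. Each lowering step leaves a term 1/(rk + e + q + 1);
    as q < m there, one copy of [rising] contains this denominator, and what remains has degree 2m -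
    1 in k, so its alternating sum vanishes. *)
Lemma sum_alt_rising_sq_pole_moment_shift x r e m q :
  0 < x -> (q <= m)%nat ->
  sum_f_R0 (fun k => alt_binom (2 * m) k
    * (rising (INR (r * k + e)) m ^ 2 * pole_moment x 0 (r * k + e + q))) (2 * m)
  = (- x) ^ q * sum_f_R0 (fun k => alt_binom (2 * m) k
    * (rising (INR (r * k + e)) m ^ 2 * pole_moment x 0 (r * k + e))) (2 * m).
Proof.
  intros Hx; induction q as [|q IH]; intros Hq.
  - rewrite Rmult_1_l; apply sum_eq; intros; now rewrite Nat.add_0_r.
  - change ((- x) ^ S q) with (- x * (- x) ^ q).
    rewrite (Rmult_assoc (- x)), <- IH, <- sum_f_R0_scal_l by lia.
    rewrite <- (Rplus_0_l (sum_f_R0 (fun k => - x * _) _)).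
    assert (E : sum_f_R0 (fun k => alt_binom (2 * m) k
      * (rising (INR r * INR k + INR (e + S q)) (m - S q)
         * (rising (INR r * INR k + INR e) q * rising (INR (r * k + e)) m))) (2 * m) = 0).
    { rewrite (sum_alt_binom _ 0); [ring|].
      eapply const_diff_lt; [|apply const_diff_mul_rising, const_diff_mul_rising,
        const_diff_rising]; lia. }
    rewrite <- E, <- sum_plus; apply sum_eq; intros k _.
    rewrite Nat.add_succ_r, pole_moment_0_S by exact Hx.
    rewrite (rising_remove (INR (r * k + e)) m q) by lia.
    rewrite <- Nat.add_succ_r, (plus_INR (r * k + e)), INR_affine, (plus_INR e).
    rewrite <- (Rplus_assoc (INR r * INR k)).
    field; rewrite <- mult_INR, <- !plus_INR; apply not_0_INR; lia.
Qed.

(** Binomial expansion of u^m = ((u + x) - x)^m. It lowers the order of the pole, so that a second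
    round of integrations by parts can raise it again. *)
Lemma pole_moment_expand x m e : 0 < x ->
  pole_moment x m (e + m)
  = sum_f_R0 (fun l => Binomial.C m l * (- x) ^ l * pole_moment x l e) m.
Proof.
  intros Hx; unfold pole_moment.
  rewrite (sum_eq _ (fun l => RInt (fun u => Binomial.C m l * (- x) ^ l
    * (u ^ e * / (u + x) ^ S l)) 0 1)).
  2:{ intros l _; now rewrite RInt_scal_R by now apply ex_RInt_pole_moment. }
  rewrite <- (proj2 (RInt_sum_f_R0 (fun l u => Binomial.C m l * (- x) ^ l
    * (u ^ e * / (u + x) ^ S l)) m (fun l =>
      ex_RInt_scal (V := R_NormedModule) _ _ _ _ (ex_RInt_pole_moment x l e Hx)))).
  apply RInt_ext; intros u; rewrite Rmin_left, Rmax_right by lra; intros Hu.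
  replace (u ^ (e + m)) with (u ^ e * (- x + (u + x)) ^ m)
    by (rewrite pow_add; do 2 f_equal; ring).
  rewrite binomial, Rmult_assoc, (Rmult_comm (sum_f_R0 _ _)), <- Rmult_assoc.
  rewrite <- sum_f_R0_scal_l; apply sum_eq; intros l Hl.
  replace ((u + x) ^ S m) with ((u + x) ^ S l * (u + x) ^ (m - l))
    by (rewrite <- pow_add; f_equal; lia).
  field; split; apply (pow_nonzero (u + x)); lra.
Qed.

(** * Legendre polynomials: coefficients, recurrence and bound *)

Fixpoint legendre_coef (M : R) (l : nat) : R :=
  match l with
  | O => 1
  | S l' => legendre_coef M l' * ((M + INR l' + 1) * (M - INR l') / (INR l' + 1) ^ 2)
  end.

Lemma legendre_coef_gt m l : (m < l)%nat -> legendre_coef (INR m) l = 0.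
Proof.
  induction 1 as [|l Hl IH]; simpl; [|rewrite IH; ring].
  unfold Rdiv; ring.
Qed.

Lemma legendre_coef_C m l : (l <= m)%nat ->
  legendre_coef (INR m) l = Binomial.C m l * (rising (INR l) m / INR (fact m)).
Proof.
  intros Hl; rewrite <- C_rising; unfold Binomial.C.
  replace (l + m - m)%nat with l by lia.
  induction l as [|l IH].
  - rewrite Nat.sub_0_r; simpl; field; apply INR_fact_neq_0.
  - simpl legendre_coef; rewrite IH by lia.
    replace (m - l)%nat with (S (m - S l)) by lia.
    replace (S l + m)%nat with (S (l + m)) by lia.
    rewrite !fact_simpl, !mult_INR, !S_INR, plus_INR, minus_INR, S_INR by lia.
    assert (0 < INR m - INR l) by (apply lt_INR in Hl; lra).
    pose proof (pos_INR l).
    field; repeat split; try apply INR_fact_neq_0; lra.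
Qed.

(** The degree M is a real parameter. Coefficients for M + 2 and M can then be expressed through
    those for M + 1, and the three-term recurrence becomes an identity of rational functions. *)
Lemma legendre_coef_up M l :
  legendre_coef (M + 1) (S l)
  = legendre_coef M l * ((M + INR l + 1) * (M + INR l + 2) / (INR l + 1) ^ 2).
Proof.
  induction l as [|l IH]; [simpl; field|].
  pose proof (pos_INR l).
  change (legendre_coef (M + 1) (S (S l))) with (legendre_coef (M + 1) (S l)
    * ((M + 1 + INR (S l) + 1) * (M + 1 - INR (S l)) / (INR (S l) + 1) ^ 2)).
  rewrite IH; change (legendre_coef M (S l)) with (legendre_coef M l
    * ((M + INR l + 1) * (M - INR l) / (INR l + 1) ^ 2)).
  rewrite !S_INR; field; lra.
Qed.

Lemma legendre_coef_down M l :
  legendre_coef M (S l)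
  = legendre_coef (M + 1) l * ((M + 1 - INR l) * (M - INR l) / (INR l + 1) ^ 2).
Proof.
  induction l as [|l IH]; [simpl; field|].
  pose proof (pos_INR l).
  change (legendre_coef M (S (S l))) with (legendre_coef M (S l)
    * ((M + INR (S l) + 1) * (M - INR (S l)) / (INR (S l) + 1) ^ 2)).
  rewrite IH; change (legendre_coef (M + 1) (S l)) with (legendre_coef (M + 1) l
    * ((M + 1 + INR l + 1) * (M + 1 - INR l) / (INR l + 1) ^ 2)).
  rewrite !S_INR; field; lra.
Qed.

(** Bonnet's recurrence read off at (-y)^(l+1): multiplying by 1 - 2y brings in the coefficient of
    index l + 1 and twice that of index l. *)
Lemma legendre_coef_rec M l :
  (M + 2) * legendre_coef (M + 2) (S l)
  = (2 * M + 3) * (legendre_coef (M + 1) (S l) + 2 * legendre_coef (M + 1) l)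
    - (M + 1) * legendre_coef M (S l).
Proof.
  pose proof (pos_INR l).
  replace (M + 2) with (M + 1 + 1) by ring.
  rewrite (legendre_coef_up (M + 1)), (legendre_coef_down M).
  change (legendre_coef (M + 1) (S l)) with (legendre_coef (M + 1) l
    * ((M + 1 + INR l + 1) * (M + 1 - INR l) / (INR l + 1) ^ 2)).
  field; lra.
Qed.

(* The Legendre polynomial P_m at 1 - 2y. *)
Definition legendre (m : nat) (y : R) : R :=
  sum_f_R0 (fun l => legendre_coef (INR m) l * (- y) ^ l) m.

Lemma legendre_trunc m L y : (m <= L)%nat ->
  legendre m y = sum_f_R0 (fun l => legendre_coef (INR m) l * (- y) ^ l) L.
Proof.
  unfold legendre; induction 1 as [|L HL IH]; [reflexivity|].
  rewrite tech5, <- IH, legendre_coef_gt by lia; ring.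
Qed.

Lemma continuous_legendre m y : continuous (legendre m) y.
Proof.
  apply (continuous_sum_f_R0 (fun l y => legendre_coef (INR m) l * (- y) ^ l)).
  intros l; apply (ex_derive_continuous (fun y => legendre_coef (INR m) l * (- y) ^ l)).
  auto_derive; exact I.
Qed.

Lemma legendre_rec m y :
  (INR m + 2) * legendre (S (S m)) y
  = (2 * INR m + 3) * (1 - 2 * y) * legendre (S m) y - (INR m + 1) * legendre m y.
Proof.
  rewrite (legendre_trunc (S (S m)) (S (S m))), (legendre_trunc m (S (S m))) by lia.
  transitivity ((2 * INR m + 3)
      * (legendre (S m) y + 2 * (- y) * legendre (S m) y)
    - (INR m + 1) * sum_f_R0 (fun l => legendre_coef (INR m) l * (- y) ^ l) (S (S m)));
    [|ring].
  rewrite (legendre_trunc (S m) (S (S m))) at 1 by lia; unfold legendre.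
  rewrite !(decomp_sum _ (S (S m))) by lia; simpl pred.
  rewrite !S_INR.
  replace (INR m + 1 + 1) with (INR m + 2) by ring.
  set (c := fun M l => legendre_coef M (S l) * (- y) ^ S l).
  change (fun i => legendre_coef (INR m + 2) (S i) * (- y) ^ S i) with (c (INR m + 2)).
  change (fun i => legendre_coef (INR m + 1) (S i) * (- y) ^ S i) with (c (INR m + 1)).
  change (fun i => legendre_coef (INR m) (S i) * (- y) ^ S i) with (c (INR m)).
  assert (E : (INR m + 2) * sum_f_R0 (c (INR m + 2)) (S m)
    = (2 * INR m + 3) * (sum_f_R0 (c (INR m + 1)) (S m)
        + 2 * (- y) * sum_f_R0 (fun l => legendre_coef (INR m + 1) l * (- y) ^ l) (S m))
      - (INR m + 1) * sum_f_R0 (c (INR m)) (S m)).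
  { unfold Rminus; rewrite <- Ropp_mult_distr_l_reverse.
    rewrite <- !sum_f_R0_scal_l, <- sum_plus, <- !sum_f_R0_scal_l, <- sum_plus.
    apply sum_eq; intros l _; unfold c.
    rewrite <- Rmult_assoc, legendre_coef_rec; simpl pow; ring. }
  simpl legendre_coef; simpl pow; rewrite !Rmult_plus_distr_l, E; ring.
Qed.

(* (1 - t^2) P_m^2 is bounded by the energy
   P_{m+1}^2 + P_m^2 - 2 t P_m P_{m+1}, which is nonincreasing in m. *)
Lemma legendre_bound m y : 0 < y < 1 -> Rabs (legendre m y) <= 1.
Proof.
  intros Hy; set (t := 1 - 2 * y).
  assert (H : legendre (S m) y ^ 2 + legendre m y ^ 2
    - 2 * t * legendre m y * legendre (S m) y <= 1 - t ^ 2).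
  { induction m as [|m IH].
    - unfold legendre, t; simpl; apply Req_le; field.
    - pose proof (legendre_rec m y) as E; fold t in E; pose proof (pos_INR m) as Hm.
      set (p := legendre m y) in *; set (p1 := legendre (S m) y) in *.
      set (p2 := legendre (S (S m)) y) in *; set (M := INR m) in *.
      (* The old energy is (t p1 - p)^2 + (1 - t^2) p1^2 and the new one is (p2 - t p1)^2 + (1 -
         t^2) p1^2; the recurrence shrinks the first square by a factor at most 1. *)
      assert (E2 : p2 - t * p1 = (M + 1) / (M + 2) * (t * p1 - p)).
      { apply (Rmult_eq_reg_l (M + 2)); [|lra].
        rewrite Rmult_minus_distr_l, E; field; lra. }
      assert (Ha : 0 <= (M + 1) / (M + 2) <= 1).
      { split; [apply Rdiv_le_0_compat; lra|apply Rle_div_l; lra]. }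
      set (al := (M + 1) / (M + 2)) in *.
      replace (p2 ^ 2 + p1 ^ 2 - 2 * t * p1 * p2)
        with ((p2 - t * p1) ^ 2 + (1 - t ^ 2) * p1 ^ 2) by ring.
      rewrite E2, Rpow_mult_distr.
      assert (al ^ 2 <= 1) by nra.
      pose proof (pow2_ge_0 (t * p1 - p)); nra. }
  assert (Ht : 0 < 1 - t ^ 2) by (unfold t; nra).
  assert (H2 : (1 - t ^ 2) * legendre m y ^ 2 <= (1 - t ^ 2) * 1).
  { pose proof (pow2_ge_0 (legendre (S m) y - t * legendre m y)); nra. }
  apply Rmult_le_reg_l in H2; [|exact Ht].
  apply Rabs_le; nra.
Qed.

(** * The alternating sum against a pole as a Legendre integral *)

Lemma sum_alt_binom_pow N z :
  sum_f_R0 (fun k => alt_binom N k * z ^ k) N = (1 - z) ^ N.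
Proof.
  replace (1 - z) with (- z + 1) by ring; rewrite binomial.
  apply sum_eq; intros k _; unfold alt_binom.
  rewrite pow1; replace (- z) with (-1 * z) by ring; rewrite Rpow_mult_distr; ring.
Qed.

(** One factor of the square raises the order of the pole from 1 to m + 1. Expanding u^m lowers it
    to l + 1, and the other factor raises it to l + m + 1 at the cost of [rising (INR l) m], which
    completes C(m, l) to the Legendre coefficient. The sum over k is then the binomial expansion of
    (1 - u^r)^(2m). *)
Lemma sum_alt_C_sq_pole_moment x r e m q : 0 < x -> (q <= m)%nat ->
  sum_f_R0 (fun k => alt_binom (2 * m) k
    * (Binomial.C (r * k + e + m) m ^ 2 * pole_moment x 0 (r * k + e + q))) (2 * m)
  = (- x) ^ q * RInt (fun u => u ^ (e + m) * (1 - u ^ r) ^ (2 * m)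
      * (legendre m (x / (u + x)) * / (u + x) ^ S m)) 0 1.
Proof.
  intros Hx Hq; pose proof (INR_fact_neq_0 m) as Hf.
  set (N := (2 * m)%nat).
  set (P := fun k => rising (INR (r * k + e)) m).
  transitivity (/ INR (fact m) ^ 2 * sum_f_R0 (fun k => alt_binom N k
    * (P k ^ 2 * pole_moment x 0 (r * k + e + q))) N).
  { rewrite <- sum_f_R0_scal_l; apply sum_eq; intros k _.
    rewrite C_rising; unfold P; field; exact Hf. }
  unfold N, P; rewrite sum_alt_rising_sq_pole_moment_shift by assumption; fold N.
  rewrite <- Rmult_assoc, (Rmult_comm (/ _)), Rmult_assoc; f_equal.
  rewrite (sum_eq _ (fun k => alt_binom N k * (P k * rising (INR (r * k + e)) m
    * pole_moment x 0 (r * k + e)))) by (intros; unfold P; ring).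
  rewrite (sum_alt_rising_pole_moment x r N m _ P m 0 e Hx (const_diff_rising r e m))
    by (unfold N; lia).
  simpl INR; simpl plus; rewrite rising_0.
  rewrite (sum_eq _ (fun k => sum_f_R0 (fun l => Binomial.C m l * (- x) ^ l
    * (alt_binom N k * (1 * rising (INR (r * k + e)) m
        * pole_moment x l (r * k + e)))) m)).
  2:{ intros k _; rewrite pole_moment_expand by exact Hx.
      rewrite <- Rmult_assoc, <- sum_f_R0_scal_l; apply sum_eq; intros l _.
      unfold P; ring. }
  rewrite sum_f_R0_swap.
  rewrite (sum_eq _ (fun l => INR (fact m) * sum_f_R0 (fun k =>
    legendre_coef (INR m) l * (- x) ^ l * alt_binom N k
      * pole_moment x (l + m) (r * k + e + m)) N)).
  2:{ intros l Hl; rewrite sum_f_R0_scal_l.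
      rewrite (sum_alt_rising_pole_moment x r N 0 1 (fun _ => 1) m l e Hx
        (fun _ => eq_refl)) by (unfold N; lia).
      rewrite legendre_coef_C by exact Hl.
      rewrite <- Rmult_assoc, <- !sum_f_R0_scal_l; apply sum_eq; intros k _.
      field; exact Hf. }
  rewrite sum_f_R0_scal_l, <- !Rmult_assoc.
  replace (/ INR (fact m) ^ 2 * INR (fact m) * INR (fact m)) with 1 by (field; exact Hf).
  rewrite Rmult_1_l.
  set (f := fun l k u => legendre_coef (INR m) l * (- x) ^ l * alt_binom N k
    * (u ^ (r * k + e + m) * / (u + x) ^ S (l + m))).
  assert (Hex : forall l k, ex_RInt (f l k) 0 1).
  { intros l k; unfold f.
    apply (ex_RInt_scal (V := R_NormedModule)), ex_RInt_pole_moment, Hx. }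
  rewrite (sum_eq _ (fun l => sum_f_R0 (fun k => RInt (f l k) 0 1) N)).
  2:{ intros l _; apply sum_eq; intros k _; unfold f, pole_moment.
      now rewrite RInt_scal_R by now apply ex_RInt_pole_moment. }
  rewrite (sum_eq _ (fun l => RInt (fun u => sum_f_R0 (fun k => f l k u) N) 0 1)).
  2:{ intros l _; symmetry; apply RInt_sum_f_R0; auto. }
  rewrite <- (proj2 (RInt_sum_f_R0 _ m (fun l => proj1 (RInt_sum_f_R0 _ N (Hex l))))).
  apply RInt_ext; intros u; rewrite Rmin_left, Rmax_right by lra; intros Hu.
  rewrite <- sum_alt_binom_pow; unfold legendre.
  rewrite (Rmult_comm (sum_f_R0 _ m)), <- Rmult_assoc, <- sum_f_R0_scal_l.
  apply sum_eq; intros l _.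
  rewrite (Rmult_comm (u ^ (e + m))), !Rmult_assoc, Rmult_comm, <- sum_f_R0_scal_l.
  apply sum_eq; intros k _; unfold f, N.
  replace (r * k + e + m)%nat with (r * k + (e + m))%nat by lia.
  replace (S (l + m)) with (l + S m)%nat by lia.
  rewrite !pow_add, pow_mult.
  replace (- (x / (u + x))) with ((- x) * / (u + x)) by (field; lra).
  rewrite Rpow_mult_distr, pow_inv.
  field; split; apply pow_nonzero; lra.
Qed.

(** With y = x/(u + x), the factor x^q u^(m-q) / (u + x)^m is y^q (1 - y)^(m-q), and u^(e+q) is
    left. Letting u and y vary independently makes B independent of x. *)
Lemma pole_bound x r e m q B : 0 < x -> (q <= m)%nat ->
  (forall u y, 0 < u < 1 -> 0 < y < 1 ->
    u ^ (e + q) * (1 - u ^ r) ^ (2 * m) * (y ^ q * (1 - y) ^ (m - q)) <= B) ->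
  Rabs (sum_f_R0 (fun k => alt_binom (2 * m) k
    * (Binomial.C (r * k + e + m) m ^ 2 * pole_moment x 0 (r * k + e + q))) (2 * m))
  <= B * RInt (fun u => / (u + x)) 0 1.
Proof.
  intros Hx Hq HB; rewrite sum_alt_C_sq_pole_moment by assumption.
  assert (Hp : ex_RInt (fun u => / (u + x)) 0 1).
  { apply ex_RInt_unit; intros; apply continuous_pole; lra. }
  set (h := fun u => u ^ (e + m) * (1 - u ^ r) ^ (2 * m)
    * (legendre m (x / (u + x)) * / (u + x) ^ S m)).
  assert (Hc : forall u, 0 <= u <= 1 -> continuous h u).
  { intros u Hu; unfold h.
    apply (continuous_mult (fun u => u ^ (e + m) * (1 - u ^ r) ^ (2 * m))).
    { apply (ex_derive_continuous (fun u => u ^ (e + m) * (1 - u ^ r) ^ (2 * m))).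
      auto_derive; exact I. }
    apply (continuous_mult (fun u => legendre m (x / (u + x)))).
    - apply (continuous_comp (fun u => x / (u + x)) (legendre m)).
      + apply (ex_derive_continuous (fun u => x / (u + x))); auto_derive; lra.
      + apply continuous_legendre.
    - apply (ex_derive_continuous (fun u => / (u + x) ^ S m)); auto_derive.
      apply (pow_nonzero (u + x) (S m)); lra. }
  apply ex_RInt_unit in Hc as Hex.
  rewrite <- RInt_scal_R, <- (RInt_scal_R B) by assumption.
  apply Rle_trans with (RInt (fun u => Rabs ((- x) ^ q * h u)) 0 1).
  - apply abs_RInt_le; [lra|].
    apply (ex_RInt_scal (V := R_NormedModule) h), Hex.
  - assert (Hscal : forall u, 0 <= u <= 1 -> continuous (fun u => (- x) ^ q * h u) u).
    { intros u Hu; apply (continuous_scal_r ((- x) ^ q) h), Hc, Hu. }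
    apply RInt_le; [lra| |apply (ex_RInt_scal (V := R_NormedModule)), Hp|].
    { apply ex_RInt_unit; intros u Hu.
      apply (continuous_comp (fun u => (- x) ^ q * h u) Rabs);
        [now apply Hscal|apply continuous_Rabs]. }
    intros u Hu; set (y := x / (u + x)).
    assert (Hy : 0 < y < 1).
    { split; [apply Rdiv_lt_0_compat; lra|apply Rlt_div_l; lra]. }
    assert (E : (- x) ^ q * h u = (-1) ^ q * legendre m y
      * (u ^ (e + q) * (1 - u ^ r) ^ (2 * m) * (y ^ q * (1 - y) ^ (m - q)) * / (u + x))).
    { unfold h; fold y.
      replace (1 - y) with (u * / (u + x)) by (unfold y; field; lra).
      replace (- x) with (-1 * (y * (u + x))) by (unfold y; field; lra).
      replace (e + m)%nat with (e + q + (m - q))%nat by lia.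
      replace ((u + x) ^ S m) with ((u + x) ^ q * (u + x) ^ (m - q) * (u + x)).
      2:{ rewrite <- pow_add, Rmult_comm; simpl; do 2 f_equal; lia. }
      rewrite !Rpow_mult_distr, (pow_add u (e + q)), pow_inv.
      field; repeat split; try apply pow_nonzero; lra. }
    rewrite E, Rabs_mult, (Rabs_mult ((-1) ^ q)), pow_1_abs, Rmult_1_l.
    assert (Hu' : 0 < / (u + x)) by (apply Rinv_0_lt_compat; lra).
    assert (0 <= 1 - u ^ r).
    { assert (u ^ r <= 1); [|lra].
      rewrite <- (pow1 r); apply pow_incr; lra. }
    assert (HP : 0 <= u ^ (e + q) * (1 - u ^ r) ^ (2 * m) * (y ^ q * (1 - y) ^ (m - q))).
    { repeat apply Rmult_le_pos; apply pow_le; lra. }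
    rewrite (Rabs_pos_eq (_ * / (u + x))) by (apply Rmult_le_pos; lra).
    rewrite <- (Rmult_1_l (B * _)); apply Rmult_le_compat; try apply Rabs_pos.
    + apply Rmult_le_pos; lra.
    + now apply legendre_bound.
    + apply Rmult_le_compat_r; [lra|now apply HB].
Qed.

(** * From poles to Stieltjes functions and Euler's constant *)

Lemma stieltjes_bound (p : R -> R) (B : R) :
  (forall u, continuous p u) -> 0 <= B ->
  (forall x, 0 < x -> Rabs (RInt (fun u => p u * / (u + x)) 0 1)
                      <= B * RInt (fun u => / (u + x)) 0 1) ->
  forall h, stieltjes h ->
    Rabs (RInt (fun u => p u * h u) 0 1) <= B * RInt h 0 1.
Proof.
  intros Hp HB Hpole.
  assert (Hex : forall h, stieltjes h -> ex_RInt h 0 1).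
  { intros h Hh; apply ex_RInt_unit; intros; now apply stieltjes_continuous. }
  assert (Hexp : forall h, stieltjes h -> ex_RInt (fun u => p u * h u) 0 1).
  { intros h Hh; apply ex_RInt_unit; intros; apply (continuous_mult p h); auto.
    now apply stieltjes_continuous. }
  assert (Hpa : ex_RInt (fun u => Rabs (p u)) 0 1).
  { apply ex_RInt_unit; intros; apply (continuous_comp p Rabs); auto.
    apply continuous_Rabs. }
  intros h Hh; pose proof Hh as Hh'.
  (* The right side is linear in h and the left side subadditive, so nonnegative combinations
     preserve the bound. *)
  induction Hh as [x Hx| |a f g Ha Hf IHf Hg IHg|f g Hf Hg IHg Hfg].
  - now apply Hpole.
  - rewrite (RInt_ext _ (fun _ => 0)), RInt_const by (intros; apply Rmult_0_r).
    unfold scal; simpl; unfold mult; simpl.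
    rewrite !Rmult_0_r, Rabs_R0; lra.
  - specialize (IHf Hf); specialize (IHg Hg).
    assert (H1 : ex_RInt (fun u => a * f u) 0 1)
      by now apply (ex_RInt_scal (V := R_NormedModule) f), Hex.
    assert (H2 : ex_RInt (fun u => a * (p u * f u)) 0 1)
      by now apply (ex_RInt_scal (V := R_NormedModule) (fun u => p u * f u)), Hexp.
    assert (E1 : RInt (fun u => a * f u + g u) 0 1 = a * RInt f 0 1 + RInt g 0 1).
    { rewrite <- RInt_scal_R by auto.
      exact (RInt_plus (V := R_CompleteNormedModule) _ _ _ _ H1 (Hex g Hg)). }
    assert (E2 : RInt (fun u => p u * (a * f u + g u)) 0 1
      = a * RInt (fun u => p u * f u) 0 1 + RInt (fun u => p u * g u) 0 1).
    { rewrite <- RInt_scal_R by auto.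
      rewrite (RInt_ext _ (fun u => a * (p u * f u) + p u * g u))
        by (intros; cbv beta; lra).
      exact (RInt_plus (V := R_CompleteNormedModule) _ _ _ _ H2 (Hexp g Hg)). }
    rewrite E1, E2.
    apply Rle_trans with (1 := Rabs_triang _ _).
    rewrite Rabs_mult, (Rabs_pos_eq a) by exact Ha.
    apply (Rmult_le_compat_l a) in IHf; lra.
  (* Replacing f by g n moves the left side by at most A/(n + 1) and the right side by at most B/(n
     + 1). *)
  - set (A := RInt (fun u => Rabs (p u)) 0 1).
    assert (HA : 0 <= A).
    { apply RInt_ge_0; [lra|exact Hpa|]; intros; apply Rabs_pos. }
    assert (H : forall n, Rabs (RInt (fun u => p u * f u) 0 1)
        <= B * RInt f 0 1 + (A + B) * / INR (S n)).
    { intros n; pose proof (lt_0_INR (S n) ltac:(lia)) as Hn.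
      assert (H1 : Rabs (RInt (fun u => p u * f u) 0 1 - RInt (fun u => p u * g n u) 0 1)
                   <= / INR (S n) * A).
      { rewrite <- (RInt_minus (V := R_CompleteNormedModule)
          (fun u => p u * f u) (fun u => p u * g n u)) by auto.
        unfold A; rewrite <- RInt_scal_R by exact Hpa.
        assert (Hc : forall u, 0 <= u <= 1 ->
          continuous (fun u => minus (p u * f u) (p u * g n u)) u).
        { intros u Hu; apply (continuous_minus (fun u => p u * f u) (fun u => p u * g n u)).
          - apply (continuous_mult p f); auto.
          - apply (continuous_mult p (g n)); auto; now apply stieltjes_continuous. }
        eapply Rle_trans; [apply abs_RInt_le; [lra|now apply ex_RInt_unit]|].
        apply RInt_le; [lra| |apply (ex_RInt_scal (V := R_NormedModule)), Hpa|].
        - apply ex_RInt_unit; intros u Hu.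
          apply (continuous_comp (fun u => minus (p u * f u) (p u * g n u)) Rabs);
            [now apply Hc|apply continuous_Rabs].
        - intros u Hu; unfold minus, plus, opp; simpl.
          replace (p u * f u + - (p u * g n u)) with ((f u - g n u) * p u) by ring.
          rewrite Rabs_mult; apply Rmult_le_compat_r; [apply Rabs_pos|].
          apply Hfg; lra. }
      assert (H2 : RInt (g n) 0 1 <= RInt f 0 1 + / INR (S n)).
      { replace (RInt f 0 1 + / INR (S n)) with (RInt (fun u => plus (f u) (/ INR (S n))) 0 1).
        - apply RInt_le; [lra|auto| |].
          + apply (ex_RInt_plus (V := R_NormedModule)); [auto|apply ex_RInt_const].
          + intros u Hu; specialize (Hfg n u ltac:(lra)).
            apply Rabs_le_between in Hfg; unfold plus; simpl; simpl in Hfg; lra.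
        - rewrite (RInt_plus (V := R_CompleteNormedModule) f) by (auto; apply ex_RInt_const).
          rewrite RInt_const; unfold plus, scal; simpl; unfold mult; simpl; ring. }
      specialize (IHg n (Hg n)).
      apply (Rmult_le_compat_l B) in H2; [|exact HB].
      assert (Htri : forall s t : R, Rabs s <= Rabs (s - t) + Rabs t)
        by (intros; split_Rabs; lra).
      specialize (Htri (RInt (fun u => p u * f u) 0 1) (RInt (fun u => p u * g n u) 0 1)).
      lra. }
    assert (L : is_lim_seq (fun n => B * RInt f 0 1 + (A + B) * / INR (S n))
                  (B * RInt f 0 1 + (A + B) * 0)).
    { apply is_lim_seq_plus'; [apply is_lim_seq_const|].
      apply is_lim_seq_mult'; [apply is_lim_seq_const|].
      apply (is_lim_seq_incr_1 (fun n => / INR n)).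
      replace (Finite 0) with (Rbar_inv p_infty) by reflexivity.
      apply is_lim_seq_inv; [apply is_lim_seq_INR|discriminate]. }
    pose proof (is_lim_seq_le _ _ _ _ H (is_lim_seq_const _) L) as H1.
    unfold Rbar_le in H1; lra.
Qed.

Lemma sum_gamma_tail_bound r e m q B : (q <= m)%nat ->
  (forall u y, 0 < u < 1 -> 0 < y < 1 ->
    u ^ (e + q) * (1 - u ^ r) ^ (2 * m) * (y ^ q * (1 - y) ^ (m - q)) <= B) ->
  Rabs (sum_f_R0 (fun k => alt_binom (2 * m) k
    * (Binomial.C (r * k + e + m) m ^ 2
       * (euler_gamma - S_ (r * k + e + q)))) (2 * m))
  <= B * euler_gamma.
Proof.
  intros Hq HB; set (N := (2 * m)%nat).
  set (w := fun k => alt_binom N k * Binomial.C (r * k + e + m) m ^ 2).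
  set (p := fun u => sum_f_R0 (fun k => w k * u ^ (r * k + e + q)) N).
  (* B is given only as an upper bound; its sign comes from the sample u = y = 1/2. *)
  assert (HB0 : 0 <= B).
  { apply Rle_trans with (2 := HB (/ 2) (/ 2) ltac:(lra) ltac:(lra)).
    assert ((/ 2) ^ r <= 1) by (rewrite <- (pow1 r); apply pow_incr; lra).
    repeat apply Rmult_le_pos; apply pow_le; lra. }
  assert (Hp : forall u, continuous p u).
  { intros u; apply continuous_sum_f_R0; intros k.
    apply (continuous_scal_r (w k) (fun u => u ^ (r * k + e + q))), continuous_pow. }
  assert (Hint : forall h, (forall u, 0 <= u <= 1 -> continuous h u) ->
    RInt (fun u => p u * h u) 0 1
    = sum_f_R0 (fun k => w k * RInt (fun u => u ^ (r * k + e + q) * h u) 0 1) N).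
  { intros h Hh.
    assert (Hx : forall k, ex_RInt (fun u => u ^ (r * k + e + q) * h u) 0 1).
    { intros k; apply ex_RInt_unit; intros u Hu.
      apply (continuous_mult (fun u => u ^ (r * k + e + q)) h); [apply continuous_pow|auto]. }
    rewrite (sum_eq _ (fun k => RInt (fun u => w k * (u ^ (r * k + e + q) * h u)) 0 1)).
    2:{ intros k _; now rewrite RInt_scal_R. }
    rewrite <- (proj2 (RInt_sum_f_R0 (fun k u => w k * (u ^ (r * k + e + q) * h u)) N
      (fun k => ex_RInt_scal (V := R_NormedModule) _ _ _ _ (Hx k)))).
    apply RInt_ext; intros u _; unfold p.
    rewrite Rmult_comm, <- sum_f_R0_scal_l; apply sum_eq; intros; ring. }
  (* The bound is uniform in K because [S_ 0 = 0] keeps the moment of exponent 0 below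
     [euler_gamma]. *)
  assert (Hbound : forall K, Rabs (sum_f_R0 (fun k => w k * gamma_moment K (r * k + e + q)) N)
    <= B * euler_gamma).
  { intros K; unfold gamma_moment.
    rewrite <- Hint by (intros; apply continuous_gamma_weight).
    apply Rle_trans with (B * RInt (gamma_weight K) 0 1).
    - apply stieltjes_bound; auto; [|apply stieltjes_gamma_weight].
      intros x Hx; rewrite Hint by (intros; apply continuous_pole; lra).
      rewrite <- (pole_bound x r e m q B Hx Hq HB); apply Req_le; f_equal; fold N.
      apply sum_eq; intros k _; unfold w; rewrite Rmult_assoc; do 2 f_equal.
      unfold pole_moment; apply RInt_ext; intros u _; now rewrite pow_1.
    - apply Rmult_le_compat_l; [exact HB0|].
      pose proof (gamma_moment_approx K 0) as [_ H]; rewrite S_0, Rminus_0_r in H.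
      rewrite <- (RInt_ext (fun u => u ^ 0 * gamma_weight K u)); [exact H|].
      intros; apply Rmult_1_l. }
  assert (Hlim : is_lim_seq (fun K => sum_f_R0 (fun k => w k * gamma_moment K (r * k + e + q)) N)
    (sum_f_R0 (fun k => w k * (euler_gamma - S_ (r * k + e + q))) N)).
  { assert (Hmom : forall i, is_lim_seq (fun K => gamma_moment K i) (euler_gamma - S_ i)).
    { intros i.
      apply (is_lim_seq_le_le (fun K => euler_gamma - S_ i - (/ 2) ^ K * / INR (S i))
        _ (fun _ => euler_gamma - S_ i));
        [intros K; apply gamma_moment_approx| |apply is_lim_seq_const].
      replace (Finite (euler_gamma - S_ i))
        with (Finite (euler_gamma - S_ i - 0 * / INR (S i))) by (f_equal; ring).
      apply is_lim_seq_minus'; [apply is_lim_seq_const|].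
      apply is_lim_seq_mult'; [|apply is_lim_seq_const].
      apply is_lim_seq_geom; rewrite Rabs_pos_eq; lra. }
    apply (is_lim_seq_sum_f_R0 (fun k K => w k * gamma_moment K (r * k + e + q))
      (fun k => w k * (euler_gamma - S_ (r * k + e + q)))).
    intros k; apply is_lim_seq_mult'; [apply is_lim_seq_const|apply Hmom]. }
  apply is_lim_seq_abs in Hlim.
  pose proof (is_lim_seq_le _ _ _ _ Hbound Hlim (is_lim_seq_const _)) as H.
  unfold Rbar_le in H; simpl in H.
  rewrite (sum_eq _ (fun k => w k * (euler_gamma - S_ (r * k + e + q)))); [exact H|].
  intros; unfold w; ring.
Qed.

(** * Maxima and the final estimate *)

Lemma exp_pow x i : exp x ^ i = exp (INR i * x).
Proof.
  induction i as [|i IH]; [now rewrite Rmult_0_l, exp_0|].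
  rewrite S_INR; simpl; rewrite IH, <- exp_plus; f_equal; ring.
Qed.

(* t <= i exp (t/i - 1), raised to the power i. *)
Lemma pow_le_exp t i : 0 <= t -> t ^ i <= INR i ^ i * exp (t - INR i).
Proof.
  intros Ht; destruct i as [|i].
  - simpl; pose proof (exp_ineq1_le (t - 0)); lra.
  - pose proof (lt_0_INR (S i) ltac:(lia)) as Hi.
    replace (t - INR (S i)) with (INR (S i) * (t / INR (S i) - 1)) by (field; lra).
    rewrite <- exp_pow, <- Rpow_mult_distr; apply pow_incr; split; [exact Ht|].
    pose proof (exp_ineq1_le (t / INR (S i) - 1)) as H.
    apply (Rmult_le_compat_l (INR (S i))) in H; [|lra].
    replace (INR (S i) * (1 + (t / INR (S i) - 1))) with t in H by (field; lra).
    exact H.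
Qed.

(** [pow_le_exp] is applied to y s and (1 - y) s with s = i + j; the exponentials cancel. The form
    without division covers i = 0 and j = 0 through 0^0 = 1. *)
Lemma beta_weight_max y i j : 0 < y < 1 ->
  y ^ i * (1 - y) ^ j * INR (i + j) ^ (i + j) <= INR i ^ i * INR j ^ j.
Proof.
  intros Hy; set (s := INR (i + j)).
  assert (Hs : 0 <= s) by apply pos_INR.
  pose proof (pow_le_exp (y * s) i ltac:(nra)) as H1.
  pose proof (pow_le_exp ((1 - y) * s) j ltac:(nra)) as H2.
  assert (H : (y * s) ^ i * ((1 - y) * s) ^ j
    <= INR i ^ i * exp (y * s - INR i) * (INR j ^ j * exp ((1 - y) * s - INR j))).
  { apply Rmult_le_compat; try assumption; apply pow_le; nra. }
  rewrite !Rpow_mult_distr in H; rewrite pow_add.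
  replace (INR i ^ i * exp (y * s - INR i) * (INR j ^ j * exp ((1 - y) * s - INR j)))
    with (INR i ^ i * INR j ^ j
          * exp (y * s - INR i + ((1 - y) * s - INR j))) in H by (rewrite exp_plus; ring).
  replace (y * s - INR i + ((1 - y) * s - INR j)) with 0 in H
    by (unfold s; rewrite plus_INR; ring).
  rewrite exp_0 in H; lra.
Qed.

(** The same argument in z = u^r with the real exponent b/r: for D = b + M r, the exponentials at z
    D / r and (1 - z) D / r cancel because D/r = b/r + M. *)
Lemma power_weight_max u b r M : (0 < b)%nat -> (0 < r)%nat -> 0 < u < 1 ->
  u ^ b * (1 - u ^ r) ^ M * Rpower (INR (b + M * r)) (INR M + INR b / INR r)
  <= Rpower (INR b) (INR b / INR r) * (INR M * INR r) ^ M.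
Proof.
  intros Hb Hr Hu; apply lt_0_INR in Hb, Hr.
  set (D := INR (b + M * r)).
  assert (ED : D = INR b + INR M * INR r) by (unfold D; now rewrite plus_INR, mult_INR).
  pose proof (pos_INR M) as HM.
  assert (HD : 0 < D) by nra.
  set (z := u ^ r).
  assert (Hz : 0 < z <= 1).
  { split; [apply pow_lt; lra|]; rewrite <- (pow1 r); apply pow_incr; lra. }
  assert (Eu : u ^ b = Rpower z (INR b / INR r)).
  { unfold z; rewrite <- (Rpower_pow r), Rpower_mult by lra.
    replace (INR r * (INR b / INR r)) with (INR b) by (field; lra).
    now rewrite Rpower_pow by lra. }
  rewrite Eu, Rpower_plus, Rpower_pow by exact HD.
  replace (Rpower z (INR b / INR r) * (1 - z) ^ M * (D ^ M * Rpower D (INR b / INR r)))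
    with (Rpower (z * D) (INR b / INR r) * ((1 - z) * D) ^ M)
    by (rewrite <- Rpower_mult_distr, Rpow_mult_distr by lra; ring).
  assert (H1 : Rpower (z * D) (INR b / INR r)
    <= Rpower (INR b) (INR b / INR r) * exp (z * D / INR r - INR b / INR r)).
  { unfold Rpower; rewrite <- exp_plus.
    pose proof (exp_ineq1_le (z * D / INR b - 1)) as H.
    assert (Hq : 0 < z * D / INR b) by (apply Rdiv_lt_0_compat; nra).
    replace (1 + (z * D / INR b - 1)) with (z * D / INR b) in H by ring.
    apply ln_le in H; [|exact Hq]; rewrite ln_exp, ln_div in H by nra.
    apply (Rmult_le_compat_l (INR b / INR r)) in H;
      [|apply Rlt_le, Rdiv_lt_0_compat; lra].
    replace (INR b / INR r * (z * D / INR b - 1))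
      with (z * D / INR r - INR b / INR r) in H by (field; lra).
    assert (Hle : INR b / INR r * ln (z * D)
      <= INR b / INR r * ln (INR b) + (z * D / INR r - INR b / INR r)) by lra.
    destruct Hle as [Hlt| ->]; [left; now apply exp_increasing|apply Rle_refl]. }
  assert (H2 : ((1 - z) * D) ^ M
    <= (INR M * INR r) ^ M * exp ((1 - z) * D / INR r - INR M)).
  { assert (Ht : 0 <= (1 - z) * D / INR r) by (apply Rdiv_le_0_compat; nra).
    pose proof (pow_le_exp _ M Ht) as H.
    apply (Rmult_le_compat_r (INR r ^ M)) in H; [|apply pow_le; lra].
    rewrite <- Rpow_mult_distr in H.
    replace ((1 - z) * D / INR r * INR r) with ((1 - z) * D) in H by (field; lra).
    rewrite (Rpow_mult_distr (INR M)); lra. }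
  apply Rle_trans with (Rpower (INR b) (INR b / INR r) * exp (z * D / INR r - INR b / INR r)
    * ((INR M * INR r) ^ M * exp ((1 - z) * D / INR r - INR M))).
  - apply Rmult_le_compat; try assumption; [apply Rlt_le, exp_pos|apply pow_le; nra].
  - apply Req_le.
    transitivity (Rpower (INR b) (INR b / INR r) * (INR M * INR r) ^ M
      * exp (z * D / INR r - INR b / INR r + ((1 - z) * D / INR r - INR M)));
      [rewrite exp_plus; ring|].
    replace (z * D / INR r - INR b / INR r + ((1 - z) * D / INR r - INR M)) with 0
      by (rewrite ED; field; lra).
    rewrite exp_0; ring.
Qed.

(** Equality holds at m = 2 (192 on both sides), and m = 1 fails (12 against 8): here the assumption
    cn >= 2 enters. *)
Lemma central_binomial_lower m : (2 <= m)%nat ->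
  3 * (INR (fact m) ^ 2 * 4 ^ m) <= 4 * INR m * INR (fact (2 * m)).
Proof.
  induction 1 as [|m Hm IH].
  - simpl; lra.
  - replace (2 * S m)%nat with (S (S (2 * m))) by lia.
    rewrite !fact_simpl, !mult_INR, !S_INR, mult_INR; simpl (INR 2); simpl pow.
    apply le_INR in Hm; simpl (INR 2) in Hm.
    set (f := INR (fact m)) in *; set (g := INR (fact (2 * m))) in *; set (M := INR m) in *.
    set (p := 4 ^ m) in *.
    assert (Hg : 0 < g) by apply INR_fact_lt_0.
    apply Rle_trans with (4 * (M + 1) ^ 2 * (4 * M * g)); [|nra].
    replace (3 * ((M + 1) * f * ((M + 1) * f * 1) * (4 * p)))
      with (4 * (M + 1) ^ 2 * (3 * (f ^ 2 * p))) by ring.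
    apply Rmult_le_compat_l; [nra|exact IH].
Qed.

(** The squared binomial has degree 2m in k with leading coefficient r^(2m) / m!^2, and the 2m-th
    difference multiplies this by (2m)!. The inverse of the value is the prefactor in the
    theorem. *)
Lemma sum_alt_C_sq r e m :
  sum_f_R0 (fun k => alt_binom (2 * m) k * Binomial.C (r * k + e + m) m ^ 2) (2 * m)
  = INR (fact (2 * m)) * INR r ^ (2 * m) / INR (fact m) ^ 2.
Proof.
  pose proof (INR_fact_neq_0 m) as Hf.
  assert (Hm : rising (INR m) m = INR (fact (2 * m)) / INR (fact m)).
  { pose proof (C_rising m m) as E; unfold Binomial.C in E.
    replace (m + m - m)%nat with m in E by lia.
    replace (m + m)%nat with (2 * m)%nat in E by lia.
    apply (Rmult_eq_reg_r (/ INR (fact m))); [|now apply Rinv_neq_0_compat].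
    unfold Rdiv in E |- *; rewrite <- E; field; exact Hf. }
  pose proof (const_diff_mul_rising m _ _ (INR r) (INR e) m (const_diff_rising r e m)) as H.
  replace (m + m)%nat with (2 * m)%nat in H by lia.
  apply sum_alt_binom in H; rewrite pow_1_even, Hm, Rmult_1_l in H.
  rewrite (sum_eq _ (fun k => / INR (fact m) ^ 2 * (alt_binom (2 * m) k
    * (rising (INR r * INR k + INR e) m * rising (INR (r * k + e)) m)))).
  2:{ intros k _; rewrite C_rising, INR_affine; field; exact Hf. }
  rewrite sum_f_R0_scal_l, H.
  replace (INR r ^ (2 * m)) with (INR r ^ m * INR r ^ m)
    by (rewrite <- pow_add; f_equal; lia).
  field; exact Hf.
Qed.

Theorem theorem3 (a b c r : nat)
  (hb : (0 < b)%nat) (hc : (0 < c)%nat) (hr : (0 < r)%nat)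
  (hab : (a <= b)%nat) (habc : (b - a <= c)%nat)
  (n : nat) (hn : (0 < n)%nat) (hnc : INR n >= 2 / INR c) :
  Rabs (euler_gamma
        - (INR (fact (c * n))) ^ 2
          / (INR (fact (2 * c * n)) * (INR r) ^ (2 * c * n))
          * sum_n (fun k =>
                     (-1) ^ k
                     * binom (2 * c * n) k
                     * (binom (r * k + (a + c) * n) (c * n)) ^ 2
                     * S_ (r * k + b * n))
                  (2 * c * n))
  < INR (c * n)
    * ((Rpower (INR b) (INR b / INR r)
        * (INR c) ^ c
        * (INR (c + a - b)) ^ (c + a - b)
        * (INR (b - a)) ^ (b - a))
       / Rpower (INR (b + 2 * c * r)) (2 * INR c + INR b / INR r)) ^ n.
Proof.
  set (T := _ / Rpower _ _).
  replace (2 * c * n)%nat with (2 * (c * n))%nat by lia.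
  set (m := (c * n)%nat); set (e := (a * n)%nat); set (q := ((b - a) * n)%nat).
  assert (Hc : 0 < INR c) by (apply lt_0_INR; lia).
  assert (Hr : 0 < INR r) by (apply lt_0_INR; lia).
  assert (Hm : (2 <= m)%nat).
  { apply INR_le; unfold m; rewrite mult_INR.
    apply Rge_le, (Rmult_le_compat_l (INR c)) in hnc; [|lra].
    replace (INR c * (2 / INR c)) with (INR 2) in hnc by (simpl; field; lra).
    exact hnc. }
  assert (HT : 0 < T).
  (* By 0^0 = 1 the bound stays positive when b = a or b - a = c. *)
  { assert (Hp : forall i, 0 < INR i ^ i).
    { intros [|i]; [simpl; lra|]; apply pow_lt, lt_0_INR; lia. }
    unfold T, Rpower; apply Rdiv_lt_0_compat; [|apply exp_pos].
    repeat apply Rmult_lt_0_compat; auto; apply exp_pos. }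
  (* [power_weight_max] with 2c for M gives (2 c r)^(2c) = c^(2c) (2r)^(2c), and the beta maximum
     divides by c^c. One c^c stays in T and (2r)^(2c) is left over. *)
  assert (HB : forall u y, 0 < u < 1 -> 0 < y < 1 ->
    u ^ (e + q) * (1 - u ^ r) ^ (2 * m) * (y ^ q * (1 - y) ^ (m - q))
    <= (T * (2 * INR r) ^ (2 * c)) ^ n).
  { intros u y Hu Hy.
    replace (e + q)%nat with (b * n)%nat
      by (unfold e, q; rewrite <- Nat.mul_add_distr_r; f_equal; lia).
    replace (2 * m)%nat with (2 * c * n)%nat by (unfold m; lia).
    replace (m - q)%nat with ((c + a - b) * n)%nat
      by (unfold m, q; rewrite <- Nat.mul_sub_distr_r; f_equal; lia).
    unfold q; rewrite !pow_mult, <- (pow_mult (1 - u ^ r) 2 c),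
      <- (pow_mult (2 * INR r) 2 c), <- !Rpow_mult_distr.
    assert (Hur : 0 <= 1 - u ^ r).
    { assert (u ^ r <= 1); [|lra]; rewrite <- (pow1 r); apply pow_incr; lra. }
    apply pow_incr; split.
    { repeat apply Rmult_le_pos; apply pow_le; lra. }
    pose proof (power_weight_max u b r (2 * c) hb hr Hu) as H1.
    pose proof (beta_weight_max y (b - a) (c + a - b) Hy) as H2.
    replace (b - a + (c + a - b))%nat with c in H2 by lia.
    replace (INR (2 * c) + INR b / INR r) with (2 * INR c + INR b / INR r) in H1
      by (rewrite mult_INR; reflexivity).
    replace (INR (2 * c)) with (2 * INR c) in H1 by (rewrite mult_INR; reflexivity).
    set (R0 := Rpower (INR (b + 2 * c * r)) _) in *.
    assert (HR0 : 0 < R0) by apply exp_pos.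
    assert (Hcc : 0 < INR c ^ c) by now apply pow_lt.
    apply (Rmult_le_reg_r (R0 * INR c ^ c)); [now apply Rmult_lt_0_compat|].
    replace (u ^ b * (1 - u ^ r) ^ (2 * c) * (y ^ (b - a) * (1 - y) ^ (c + a - b))
      * (R0 * INR c ^ c))
      with (u ^ b * (1 - u ^ r) ^ (2 * c) * R0
        * (y ^ (b - a) * (1 - y) ^ (c + a - b) * INR c ^ c)) by ring.
    replace (T * (2 * INR r) ^ (2 * c) * (R0 * INR c ^ c))
      with (Rpower (INR b) (INR b / INR r) * (2 * INR c * INR r) ^ (2 * c)
        * (INR (b - a) ^ (b - a) * INR (c + a - b) ^ (c + a - b))).
    2:{ unfold T; fold R0.
        replace (2 * INR c * INR r) with (INR c * (2 * INR r)) by ring.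
        rewrite (Rpow_mult_distr (INR c)).
        replace (INR c ^ (2 * c)) with (INR c ^ c * INR c ^ c)
          by (rewrite <- pow_add; f_equal; lia).
        field; lra. }
    apply Rmult_le_compat; [| |exact H1|exact H2].
    - apply Rmult_le_pos; [apply Rmult_le_pos; apply pow_le; lra|lra].
    - apply Rmult_le_pos; [apply Rmult_le_pos; apply pow_le; lra|lra]. }
  assert (Hq : (q <= m)%nat) by (apply Nat.mul_le_mono_r, habc).
  pose proof (sum_gamma_tail_bound r e m q _ Hq HB) as Hmain.
  rewrite sum_n_Reals.
  set (w := fun k => alt_binom (2 * m) k * Binomial.C (r * k + e + m) m ^ 2).
  rewrite (sum_eq _ (fun k => w k * S_ (r * k + e + q))).
  2:{ intros k _; unfold w, binom, alt_binom.
      replace (r * k + (a + c) * n)%nat with (r * k + e + m)%nat by (unfold e, m; lia).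
      replace (r * k + b * n)%nat with (r * k + e + q)%nat; [reflexivity|].
      unfold e, q; rewrite <- Nat.add_assoc, <- Nat.mul_add_distr_r; do 2 f_equal; lia. }
  rewrite (sum_eq _ (fun k => euler_gamma * w k + -1 * (w k * S_ (r * k + e + q)))) in Hmain
    by (intros; unfold w; ring).
  rewrite sum_plus, !sum_f_R0_scal_l in Hmain.
  unfold w in Hmain at 1; rewrite sum_alt_C_sq in Hmain.
  set (sigma := sum_f_R0 _ _) in *.
  set (A := INR (fact (2 * m)) * INR r ^ (2 * m)) in *.
  pose proof (INR_fact_lt_0 m) as Hf; pose proof (INR_fact_lt_0 (2 * m)) as Hf2.
  assert (HA : 0 < A) by (apply Rmult_lt_0_compat; [|apply pow_lt]; lra).
  assert (Hf1 : 0 < INR (fact m) ^ 2) by now apply pow_lt.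
  replace (euler_gamma - INR (fact m) ^ 2 / A * sigma)
    with (INR (fact m) ^ 2 / A * (euler_gamma * (A / INR (fact m) ^ 2) + -1 * sigma))
    by (field; lra).
  assert (Hfa : 0 < INR (fact m) ^ 2 / A) by now apply Rdiv_lt_0_compat.
  rewrite Rabs_mult, (Rabs_pos_eq (_ / A)) by lra.
  apply Rle_lt_trans with (INR (fact m) ^ 2 / A
    * ((T * (2 * INR r) ^ (2 * c)) ^ n * euler_gamma));
    [apply Rmult_le_compat_l; lra|].
  (* Here r^(2m) cancels against the prefactor, and 4^m meets the central binomial coefficient. *)
  assert (E : (T * (2 * INR r) ^ (2 * c)) ^ n = T ^ n * (4 ^ m * INR r ^ (2 * m))).
  { rewrite Rpow_mult_distr, <- pow_mult.
    replace (2 * c * n)%nat with (2 * m)%nat by (unfold m; lia).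
    rewrite Rpow_mult_distr, pow_mult; do 3 f_equal; ring. }
  rewrite E.
  pose proof (central_binomial_lower m Hm) as Hcb.
  pose proof euler_gamma_le as Hg.
  assert (HTn : 0 < T ^ n) by now apply pow_lt.
  assert (Hrm : 0 < INR r ^ (2 * m)) by now apply pow_lt.
  assert (H4 : 0 < 4 ^ m) by (apply pow_lt; lra).
  assert (HM : 0 < INR m) by (apply lt_0_INR; lia).
  replace (INR (fact m) ^ 2 / A * (T ^ n * (4 ^ m * INR r ^ (2 * m)) * euler_gamma))
    with (INR (fact m) ^ 2 * 4 ^ m / INR (fact (2 * m)) * euler_gamma * T ^ n)
    by (unfold A; field; lra).
  apply Rmult_lt_compat_r; [exact HTn|].
  set (rho := INR (fact m) ^ 2 * 4 ^ m / INR (fact (2 * m))).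
  assert (Hrho : 0 < rho).
  { apply Rdiv_lt_0_compat; [now apply Rmult_lt_0_compat|exact Hf2]. }
  assert (Hrho2 : rho <= 4 / 3 * INR m) by (apply Rle_div_l; lra).
  (* Strictness comes from 4/3 * 2/3 = 8/9 < 1. *)
  apply Rle_lt_trans with (rho * (2 / 3)); [apply Rmult_le_compat_l; lra|lra].
Qed.
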